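(* Let $p\in(1,\infty)\setminus\{2\}$. Then there exists $c_p\in(0,1)$ such that the following is true. Fix a nonzero Schwartz function $\mathfrak m\colon\mathbb R\to\mathbb C$ supported on $\mathbf Q=[-1/2,1/2]$ and let $(\vartheta_N)_{N\in\mathbb Z_+}$ be a given sequence of numbers $\vartheta_N\in(0,1)$. Then, for infinitely many $N\in\mathbb Z_+$, we have $$\big\|T_{\mathbb Z}\big[[\![1\mid\mathfrak m_{\varepsilon_N}]\!]_{\mathcal R_{\le N}}\big]\big\|_{\ell^p(\mathbb Z)\to\ell^p(\mathbb Z)}\gtrsim_p e^{(\log N)^{c_p}}=N^{1/(\log N)^{1-c_p}}$$ with some $0<\varepsilon_N\le\vartheta_N$, where $\mathfrak m_{\varepsilon_N}(x)=\mathfrak m(x/\varepsilon_N)$.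
   Context: Notation. $\mathbb Z_+=\{1,2,\dots\}$, $\mathbb T=\mathbb R/\mathbb Z$, $e(z)=e^{2\pi i z}$, $\log$ is the natural logarithm. $A\gtrsim_p B$ means $A\ge cB$ with a constant $c>0$ depending only on $p$. $\mathcal R_{\le N}=\{a/q\in\mathbb Q/\mathbb Z: q\in\{1,\dots,N\},\ \gcd(a,q)=1\}$ is the set of canonical fractions, with $a/q$ identified with $a/q+\mathbb Z$. For a finite set $\Sigma\subset\mathbb T$, $[\![1\mid\mathfrak m]\!]_\Sigma(\xi)=\sum_{\sigma\in\Sigma}\mathfrak m(\xi-\sigma)$ for $\xi\in\mathbb T$, where a function on $\mathbb R$ supported in $[-1/2,1/2]$ is viewed as a function on $\mathbb T$ by identifying $\mathbb T$ with $[-1/2,1/2]$ up to measure zero. $T_{\mathbb Z}[\mathfrak m]f(x)=\int_{\mathbb T}\mathfrak m(\xi)\,\mathcal F_{\mathbb Z}f(\xi)\,e(x\xi)\,d\xi$ for $x\in\mathbb Z$, where $\mathcal F_{\mathbb Z}f(\xi)=\sum_{x\in\mathbb Z}f(x)e(-x\xi)$; $\|\cdot\|_{\ell^p(\mathbb Z)\to\ell^p(\mathbb Z)}$ denotes the operator norm. *)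

(* Defs.v *)
From HB Require Import structures.
From mathcomp Require Import all_boot all_order all_algebra.
From mathcomp Require Import all_classical all_reals all_analysis.
From mathcomp Require Import finmap complex.

Set Implicit Arguments.
Unset Strict Implicit.
Unset Printing Implicit Defensive.
Import Order.TTheory GRing.Theory Num.Theory.
Import numFieldNormedType.Exports.

Local Open Scope classical_set_scope.
Local Open Scope complex_scope.
Local Open Scope ring_scope.

Section Defs.
Context {R : realType}.
Implicit Types (f : R -> R[i]) (u : int -> R[i]) (p : R).

(* A complex-valued function of a real variable is differentiated and
   integrated through its real and imaginary parts. *)
Definition re_fun f : R -> R := fun x => complex.Re (f x).
Definition im_fun f : R -> R := fun x => complex.Im (f x).

Definition cderiv n f : R -> R[i] :=
  fun x => derive1n n (re_fun f) x +i* derive1n n (im_fun f) x.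

Definition cintegral (D : set R) f : R[i] :=
  (\int[lebesgue_measure]_(x in D) re_fun f x) +i*
  (\int[lebesgue_measure]_(x in D) im_fun f x).

Definition smooth f := forall n x,
  derivable (derive1n n (re_fun f)) x 1 /\
  derivable (derive1n n (im_fun f)) x 1.

Definition schwartz f := smooth f /\
  forall k n : nat, exists M : R, forall x,
    `|x| ^+ k * Normc.normc (cderiv n f x) <= M.

Definition Q : set R := `[- 2^-1, 2^-1].

(* Q is closed, so vanishing off Q is the same as having support (the closure
   of the non-vanishing set) inside Q. *)
Definition supported_on_Q f := forall x, ~ Q x -> f x = 0.

Definition dilate f (eps : R) : R -> R[i] := fun x => f (x / eps).

(* e(z) = exp (2 pi i z) *)
Definition e (z : R) : R[i] := cos (2 * pi * z) +i* sin (2 * pi * z).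

(* Points of T = R/Z are represented by real numbers, functions on T by
   1-periodic functions on R. [torus_fun f] is the function on T obtained from
   f by identifying T with [-1/2, 1/2[: the argument is reduced modulo 1 to its
   representative in that interval. *)
Definition torus_fun f : R -> R[i] :=
  fun x => f (x - (Num.floor (x + 2^-1))%:~R).

(* The finite set S of points of T is given by one real representative per
   point: elements of S must be pairwise distinct modulo 1. *)
Definition bracket (S : {fset R}) f : R -> R[i] :=
  fun xi => \sum_(s <- S) torus_fun f (xi - s).

(* Every class a/q + Z with gcd(a, q) = 1 has exactly one representative with
   0 <= a < q (for q = 1 this is a = 0, since gcd(0, 1) = 1). *)
Definition canonical_fractions (N : nat) : {fset R} :=
  [fset x in [seq (a%:R / q%:R : R) | q <- iota 1 N,
                                      a <- [seq a <- iota 0 q | coprime a q]]]%fset.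

Definition finitely_supported u := finite_set [set x | u x != 0].

Definition fourierZ u : R -> R[i] :=
  fun xi => \sum_(x \in [set: int]) u x * e (- (x%:~R * xi)).

(* [phi] is a 1-periodic function and T is identified with Q. *)
Definition TZ (phi : R -> R[i]) u : int -> R[i] :=
  fun x => cintegral Q (fun xi => phi xi * fourierZ u xi * e (x%:~R * xi)).

Definition lp_norm p u : \bar R :=
  ((\esum_(x in [set: int]) (Normc.normc (u x) `^ p)%:E) `^ p^-1)%E.

(* Operator norm on l^p(Z), 1 <= p < oo, of an operator given by its values on
   the finitely supported sequences, which are dense in l^p(Z); it is +oo when
   the operator has no bounded extension to l^p(Z). *)
Definition lp_opnorm p (A : (int -> R[i]) -> (int -> R[i])) : \bar R :=
  ereal_sup [set lp_norm p (A u) | u in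
    [set u | finitely_supported u /\ (lp_norm p u <= 1)%E]].

End Defs.

(* Main.v *)
Require Import Defs.
From HB Require Import structures.
From mathcomp Require Import all_boot all_order all_algebra.
From mathcomp Require Import all_classical all_reals all_analysis.
From mathcomp Require Import finmap complex.
From mathcomp Require Import ring lra zify.
Import Order.TTheory GRing.Theory Num.Theory.
Import numFieldNormedType.Exports.
Import ComplexField.Normc.

(** The idea. Let D_N be the Dirichlet kernel of the canonical fractions, that
    is, the sum of e(s x) over all s in R_N. When eps is tiny the multiplier is
    convolution with D_N times a profile that hardly varies over the periods of
    D_N (lemma TZ_bracket), so its norm is at least a constant kap, depending
    on m, times the norm of convolution with D_N on functions on Z/W, where W
    is a common multiple of all denominators (theorem transference). The
    constant is positive because the inverse Fourier transform of m does not
    vanish identically (lemma inverse_fourier_neq0). Convolution with D_N, once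
    normalized, is the projection onto the characters of denominator at most N.

    To see that this projection has large norm on l^p, take pairwise coprime
    moduli q_1, ..., q_n of comparable sizes. The functions on Z/q_i behave like
    independent random variables, and a product of nonconstant characters over
    the moduli in a set S has exact denominator the product of these moduli.
    For suitable N this product is at most N exactly when S has at most k
    elements (lemma modulus_level), so on such functions the projection is the
    truncation to degree at most k in n independent variables.

    Test it on Riesz products: F is the product of the 1 + c h_i and G that of
    the 1 + c' h_i, where h_i(x) = 2 cos(2 pi x / q_i), with one of c, c' real
    and the other imaginary. The pairing of G with the truncation of F is the
    truncation of degree k of the expansion of (1 + 2 c c') ^ n (lemma
    pairing_riesz). As 2 c c' = i b is imaginary, a well chosen k gives modulus
    at least (1 + b) ^ n / (2 (n + 1)) (lemma large_truncation), although the
    full sum is much smaller. On the other hand the norms of F and G are n-th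
    powers. An imaginary perturbation costs half of its variance for every
    exponent, while a real one costs (r - 1) / r < 1/2 of its variance for an
    exponent r < 2 (lemmas imaginary_factor_norm and real_factor_norm). For
    p <> 2 exactly one of p and its conjugate exponent is below 2; putting the
    real perturbation there, the product of the norms is smaller than
    (1 + b) ^ n by an exponential factor exp(dl n) (lemma gain_exists).

    Finally ln N <= 4 n ^ 3, so the growth exp(dl n) exceeds exp((ln N) ^ (1/4))
    for all large n, whatever the constant kap. This allows c = 1/4 and C = 1
    for every p. *)

Local Open Scope classical_set_scope.
Local Open Scope ring_scope.


Set Implicit Arguments.
Unset Strict Implicit.
Unset Printing Implicit Defensive.


(** * The character e and the modulus of complex numbers *)

Section Exponential.
Context {R : realType}.
Implicit Types (x y z : R) (u v w : R[i]).

Lemma normc_ge0 u : 0 <= normc u.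
Proof. by case: u => a b; exact: sqrtr_ge0. Qed.

Lemma normc_sum (I : Type) (r : seq I) (P : pred I) (F : I -> R[i]) :
  normc (\sum_(i <- r | P i) F i) <= \sum_(i <- r | P i) normc (F i).
Proof.
elim/big_ind2: _ => [|u x v y ux vy|//]; first by rewrite normc0.
by rewrite (le_trans (le_normcD _ _))// lerD.
Qed.

Lemma normcB_le u v : normc u - normc v <= normc (u - v).
Proof. by rewrite lerBlDr -{1}(subrK v u) le_normcD. Qed.

Lemma normc_real x : normc x%:C%C = `|x|.
Proof. by rewrite /= expr0n addr0 sqrtr_sqr. Qed.

Lemma normc_prod (I : Type) (r : seq I) (F : I -> R[i]) :
  normc (\prod_(i <- r) F i) = \prod_(i <- r) normc (F i).
Proof. by elim/big_ind2: _ => [|u x v y <- <-|//]; rewrite ?normc1 ?normcM. Qed.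

Lemma normcX u n : normc (u ^+ n) = normc u ^+ n.
Proof. by elim: n => [|n IH]; rewrite ?normc1// !exprS normcM IH. Qed.

Lemma normc_le_ReIm u : normc u <= `|complex.Re u| + `|complex.Im u|.
Proof.
case: u => a b /=.
rewrite -[leRHS]ger0_norm ?addr_ge0// -sqrtr_sqr ler_wsqrtr//.
rewrite sqrrD !real_normK ?num_real// lerD2r lerDl.
by rewrite mulrn_wge0// mulr_ge0.
Qed.

Lemma Re_le_normc u : `|complex.Re u| <= normc u.
Proof. by case: u => a b /=; rewrite -sqrtr_sqr ler_wsqrtr// lerDl sqr_ge0. Qed.

Lemma Im_le_normc u : `|complex.Im u| <= normc u.
Proof. by case: u => a b /=; rewrite -sqrtr_sqr ler_wsqrtr// lerDr sqr_ge0. Qed.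

Lemma eD x y : e (x + y) = e x * e y.
Proof.
by rewrite /e mulrDr cosD sinD; apply/eqP; rewrite eq_complex /= eqxx/= addrC.
Qed.

Lemma e0 : e (0 : R) = 1.
Proof. by rewrite /e mulr0 cos0 sin0. Qed.

Lemma normc_e x : normc (e x) = 1.
Proof. by rewrite /= cos2Dsin2 sqrtr1. Qed.

Lemma e1 : e (1 : R) = 1.
Proof. by rewrite /e mulr1 mulr_natl cos2pi sin2pi. Qed.

Lemma eN x : e (- x) = (e x)^-1.
Proof.
have /(congr1 (fun u => u * (e x)^-1)) : e (- x) * e x = 1 :> R[i].
  by rewrite -eD addNr e0.
rewrite mulfK ?mul1r//; apply/eqP => ex0.
by have := normc_e x; rewrite ex0 normc0 => /esym/eqP; rewrite oner_eq0.
Qed.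

Lemma e_nat n : e (n%:R : R) = 1.
Proof. by elim: n => [|n IH]; rewrite ?e0// -addn1 natrD eD IH e1 mulr1. Qed.

Lemma e_int (k : int) : e (k%:~R : R) = 1.
Proof. by case: (intP k) => [|n|n]; rewrite ?e0// ?mulrNz ?eN e_nat ?invr1. Qed.

Lemma eDint x (k : int) : e (x + k%:~R) = e x.
Proof. by rewrite eD e_int mulr1. Qed.

Lemma e_neq1 x : 0 < x < 1 -> e x != 1.
Proof.
move=> /andP[x0 x1]; rewrite eq_complex /= negb_and; apply/orP; left.
rewrite (_ : 2 * pi * x = (pi * x) *+ 2); last by rewrite -mulrA mulr_natl.
rewrite cos_mulr2n cos2sin2.
have : 0 < sin (pi * x).
  by apply: sin_gt0_pi; rewrite mulr_gt0 ?pi_gt0//= gtr_pMr ?pi_gt0.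
move: (sin _) => s s0; rewrite lt_eqF//.
have : 0 < s ^+ 2 by rewrite exprn_gt0.
by rewrite -mulr_natl; lra.
Qed.

Lemma lipschitz_derive (f df : R -> R) (x y k : R) :
  (forall z, is_derive z 1 f (df z)) -> (forall z, `|df z| <= k) ->
  `|f x - f y| <= k * `|x - y|.
Proof.
move=> Df bf; wlog xy : x y / y <= x.
  move=> H; case: (leP y x) => [/H//|/ltW /H].
  by rewrite distrC (distrC y x).
have cf : {within `[y, x], continuous f}.
  apply: continuous_subspaceT => z; apply: differentiable_continuous.
  by apply/derivable1_diffP; exact: ex_derive.
have [c _ ->] := MVT_segment xy (fun z _ => Df z) cf.
by rewrite normrM ler_wpM2r.
Qed.

Lemma e_lipschitz x y : normc (e x - e y) <= 4 * pi * `|x - y|.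
Proof.
apply: le_trans (normc_le_ReIm _) _ => /=.
have -> : 4 * pi * `|x - y| = 1 * `|2 * pi * x - 2 * pi * y| + 1 * `|2 * pi * x - 2 * pi * y|.
  by rewrite -mulrBr normrM (ger0_norm (_ : 0 <= 2 * pi)) ?mulr_ge0 ?pi_ge0//; lra.
apply: lerD.
  apply: (@lipschitz_derive cos (fun z => - sin z)) => z.
  by rewrite normrN sin_max.
apply: (@lipschitz_derive sin cos) => z; exact: cos_max.
Qed.

End Exponential.


(** * Integrals of continuous functions on segments *)

Section RealIntegrals.
Context {R : realType}.
Notation mu := (@lebesgue_measure R).
Implicit Types (f h : R -> R).

Lemma integrable_cont f (a b : R) : continuous f ->
  mu.-integrable `[a, b] (EFin \o f).
Proof.
move=> cf; apply: continuous_compact_integrable; first exact: segment_compact.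
exact: continuous_subspaceT.
Qed.

Lemma continuous_affine f (k b : R) : continuous f ->
  continuous (fun x => f (k * x + b)).
Proof.
move=> cf x; apply: (@continuous_comp _ _ _ (fun x => k * x + b) f); last exact: cf.
apply: cvgD; last exact: cvg_cst.
by apply: cvgM; [exact: cvg_cst|exact: cvg_id].
Qed.

Lemma Rintegral_affine f (k b u v : R) : 0 < k -> u <= v -> continuous f ->
  k * \int[mu]_(x in `[u, v]) f (k * x + b) =
  \int[mu]_(x in `[k * u + b, k * v + b]) f x.
Proof.
move=> k0 uv cf.
pose F x := k * x + b.
have DF (x : R) : is_derive x (1 : R) F k.
  by rewrite /F; apply: is_derive_eq; rewrite addr0 /GRing.scale/= mulr1.
have F'E : F^`()%classic = cst k.
  by apply/funext => x; rewrite derive1E; exact: derive_val.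
have cF : continuous F.
  by move=> x; apply/differentiable_continuous/derivable1_diffP; exact: ex_derive.
have := @integration_by_substitution_increasing R F f u v uv _ _ _ _ _ _.
rewrite F'E => H.
transitivity (\int[mu]_(x in `[u, v]) (k * f (F x))).
  rewrite RintegralZl//.
  by apply: integrable_cont; exact: continuous_affine.
rewrite /Rintegral H//.
- congr fine; apply: eq_integral => x _; rewrite /= /F.
  by rewrite mulrC.
- by move=> x y _ _ xy; rewrite /F ltrD2r ltr_pM2l.
- by move=> x _; exact: cst_continuous.
- exact: is_cvg_cst.
- exact: is_cvg_cst.
- split.
  + by move=> x _; exact: ex_derive.
  + by apply: cvg_at_right_filter; exact: cF.
  + by apply: cvg_at_left_filter; exact: cF.
- exact: continuous_subspaceT.
Qed.

(** Comparing integrals over different windows: as soon as the window contains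
    the support, it can be replaced by the whole line. *)
Lemma Rintegral_supp f (A B : set R) : (forall x, ~ A x -> f x = 0) ->
  A `<=` B -> \int[mu]_(x in A) f x = \int[mu]_(x in B) f x.
Proof.
move=> fA AB; rewrite Rintegral_mkcond [RHS]Rintegral_mkcond.
congr (Rintegral mu setT _); apply/funext => x; rewrite !patchE.
case: ifPn => [/set_mem/AB/mem_set -> //|]; case: ifPn => // _.
by move=> /negP H; rewrite fA// => /mem_set.
Qed.

Lemma Rintegral_supp2 f (A B D : set R) : (forall x, ~ A x -> f x = 0) ->
  A `<=` B -> A `<=` D -> \int[mu]_(x in B) f x = \int[mu]_(x in D) f x.
Proof. by move=> fA AB AD; rewrite -(Rintegral_supp fA AB) (Rintegral_supp fA AD). Qed.

Lemma Rintegral_le_bound f (a b k : R) : a <= b -> continuous f ->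
  (forall x, x \in `[a, b] -> `|f x| <= k) ->
  `|\int[mu]_(x in `[a, b]) f x| <= k * (b - a).
Proof.
move=> ab cf bf.
have nf : continuous (fun x => `|f x|).
  by move=> x; apply: continuous_comp; [exact: cf|exact: norm_continuous].
apply: le_trans.
  by apply: le_normr_Rintegral => //; exact: integrable_cont.
have -> : k * (b - a) = \int[mu]_(x in `[a, b]) k.
  rewrite Rintegral_cst//= lebesgue_measure_itv/= lte_fin.
  case: ltgtP ab => //= ->; by rewrite subrr mulr0.
apply: le_Rintegral => //; first exact: integrable_cont.
  by apply: integrable_cont => x; exact: cst_continuous.
Qed.

(** The translate of f by s leaves the window Q on the right, and what is lost
    re-enters on the left through the translate by one more period; together
    the two windows cover the whole support of f exactly once. *)
Lemma Rintegral_wrap f (s : R) : 0 <= s < 1 -> continuous f ->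
  (forall x, ~ (@Q R) x -> f x = 0) ->
  \int[mu]_(x in @Q R) (f (x - s) + f (x - s + 1)) = \int[mu]_(x in @Q R) f x.
Proof.
move=> /andP[s0 s1] cf fQ.
have E x : f (x - s) + f (x - s + 1) = f (1 * x + - s) + f (1 * x + (1 - s)).
  by rewrite mul1r; congr (_ + f _); ring.
under eq_Rintegral do rewrite E.
rewrite RintegralD//=; first last.
- by apply: integrable_cont; exact: continuous_affine.
- by apply: integrable_cont; exact: continuous_affine.
- exact: measurable_itv.
have h2 : (- 2^-1 : R) <= 2^-1 by lra.
have A1 := @Rintegral_affine f 1 (- s) _ _ ltr01 h2 cf.
have A2 := @Rintegral_affine f 1 (1 - s) _ _ ltr01 h2 cf.
rewrite mul1r in A1; rewrite mul1r in A2; rewrite !mul1r in A1 A2.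
rewrite (_ : - 2^-1 + (1 - s) = 2^-1 - s :> R) in A2; last lra.
apply: (etrans (congr2 +%R A1 A2)) => {A1 A2}.
have I : mu.-integrable `[- 2^-1 - s, 2^-1 + (1 - s)] (EFin \o f).
  exact: integrable_cont.
have := @Rintegral_itvB R f (BLeft (- 2^-1 - s)) (BRight (2^-1 + (1 - s))) (2^-1 - s) I.
rewrite !bnd_simp => /(_ _ _) H.
rewrite -(@Rintegral_itv_obnd_cbnd R (2^-1 - s)); last first.
  apply: integrableS I => //; apply: subset_itv; rewrite bnd_simp; lra.
rewrite -H ?bnd_simp; try lra.
rewrite addrC subrK; apply: (@Rintegral_supp2 _ (@Q R)) => //.
by move=> x /=; rewrite /Q/= !in_itv/= => /andP[? ?]; apply/andP; split; lra.
Qed.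

End RealIntegrals.


(** * Integrals of complex functions over a period *)

Section ComplexIntegrals.
Context {R : realType}.
Notation mu := (@lebesgue_measure R).
Implicit Types (f g : R -> R[i]).

(** Continuity is stated on real and imaginary parts because integration of
    complex functions is defined through them. *)
Definition ccont f := continuous (re_fun f) /\ continuous (im_fun f).

Lemma complex_ReD (u v : R[i]) : complex.Re (u + v) = complex.Re u + complex.Re v.
Proof. by case: u; case: v. Qed.
Lemma complex_ImD (u v : R[i]) : complex.Im (u + v) = complex.Im u + complex.Im v.
Proof. by case: u; case: v. Qed.
Lemma complex_ReM (u v : R[i]) : complex.Re (u * v) =
  complex.Re u * complex.Re v - complex.Im u * complex.Im v.
Proof. by case: u; case: v. Qed.
Lemma complex_ImM (u v : R[i]) : complex.Im (u * v) =
  complex.Re u * complex.Im v + complex.Im u * complex.Re v.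
Proof. by case: u; case: v. Qed.

Lemma complexP (u v : R[i]) :
  complex.Re u = complex.Re v -> complex.Im u = complex.Im v -> u = v.
Proof. by case: u; case: v => a b c d /= -> ->. Qed.

Lemma ccontD f g : ccont f -> ccont g -> ccont (fun x => f x + g x).
Proof.
move=> [rf jf] [rg jg]; split.
  rewrite (_ : re_fun _ = fun x => re_fun f x + re_fun g x); last first.
    by apply/funext => x; rewrite /re_fun complex_ReD.
  by move=> x; apply: cvgD; [exact: rf|exact: rg].
rewrite (_ : im_fun _ = fun x => im_fun f x + im_fun g x); last first.
  by apply/funext => x; rewrite /im_fun complex_ImD.
by move=> x; apply: cvgD; [exact: jf|exact: jg].
Qed.

Lemma ccontM f g : ccont f -> ccont g -> ccont (fun x => f x * g x).
Proof.
move=> [rf jf] [rg jg]; split.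
  rewrite (_ : re_fun _ =
      fun x => re_fun f x * re_fun g x - im_fun f x * im_fun g x); last first.
    by apply/funext => x; rewrite /re_fun complex_ReM.
  by move=> x; apply: cvgB; apply: cvgM; [exact: rf|exact: rg|exact: jf|exact: jg].
rewrite (_ : im_fun _ =
    fun x => re_fun f x * im_fun g x + im_fun f x * re_fun g x); last first.
  by apply/funext => x; rewrite /im_fun complex_ImM.
by move=> x; apply: cvgD; apply: cvgM; [exact: rf|exact: jg|exact: jf|exact: rg].
Qed.

Lemma ccont_cst (c : R[i]) : ccont (fun=> c).
Proof. by split => x; exact: cst_continuous. Qed.

Lemma ccont_sum (I : Type) (r : seq I) (F : I -> R -> R[i]) :
  (forall i, ccont (F i)) -> ccont (fun x => \sum_(i <- r) F i x).
Proof.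
move=> cF; elim: r => [|i r IH].
  by under eq_fun do rewrite big_nil; exact: ccont_cst.
by under eq_fun do rewrite big_cons; apply: ccontD.
Qed.

Lemma ccont_affine f (k b : R) : ccont f -> ccont (fun x => f (k * x + b)).
Proof.
move=> [rf jf]; split.
  exact: (continuous_affine (f := re_fun f)).
exact: (continuous_affine (f := im_fun f)).
Qed.

Lemma ccont_shift f (b : R) : ccont f -> ccont (fun x => f (x + b)).
Proof. by move=> /(ccont_affine 1 b); under eq_fun do rewrite mul1r. Qed.

Lemma ccont_e (k : R) : ccont (fun x => e (k * x)).
Proof.
suff [c s] : ccont (e : R -> R[i]).
  have := ccont_affine k 0 (conj c s).
  by under eq_fun do rewrite addr0.
split.
  rewrite (_ : re_fun _ = fun x => cos (2 * pi * x + 0)); last first.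
    by apply/funext => x; rewrite addr0.
  apply: continuous_affine; exact: continuous_cos.
rewrite (_ : im_fun _ = fun x => sin (2 * pi * x + 0)); last first.
  by apply/funext => x; rewrite addr0.
apply: continuous_affine; exact: continuous_sin.
Qed.

Lemma eq_cintegral f g : (forall x, (@Q R) x -> f x = g x) ->
  cintegral (@Q R) f = cintegral (@Q R) g.
Proof.
move=> fg; rewrite /cintegral; congr (_ +i* _)%C; apply: eq_Rintegral => x /set_mem/fg E;
by rewrite /re_fun /im_fun E.
Qed.

Lemma cintegralD f g : ccont f -> ccont g ->
  cintegral (@Q R) (fun x => f x + g x) = cintegral (@Q R) f + cintegral (@Q R) g.
Proof.
move=> [rf jf] [rg jg]; rewrite /cintegral /Q.
apply: complexP; rewrite ?complex_ReD ?complex_ImD/=.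
  under eq_Rintegral do rewrite /re_fun complex_ReD.
  by rewrite RintegralD//; exact: integrable_cont.
under eq_Rintegral do rewrite /im_fun complex_ImD.
by rewrite RintegralD//; exact: integrable_cont.
Qed.

Lemma cintegralZ (c : R[i]) f : ccont f ->
  cintegral (@Q R) (fun x => c * f x) = c * cintegral (@Q R) f.
Proof.
move=> [rf jf]; rewrite /cintegral /Q.
have I (k : R) (h : R -> R) : continuous h ->
    mu.-integrable `[- 2^-1, 2^-1] (EFin \o (fun x => k * h x)).
  move=> ch; apply: integrable_cont => x.
  by apply: cvgM; [exact: cvg_cst|exact: ch].
apply: complexP; rewrite ?complex_ReM ?complex_ImM/=.
  under eq_Rintegral do rewrite /re_fun complex_ReM.
  rewrite RintegralB//; [|exact: I..].
  by rewrite !RintegralZl//; exact: integrable_cont.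
under eq_Rintegral do rewrite /im_fun complex_ImM.
rewrite RintegralD//; [|exact: I..].
by rewrite !RintegralZl//; exact: integrable_cont.
Qed.

Lemma cintegral_sum (I : Type) (r : seq I) (F : I -> R -> R[i]) :
  (forall i, ccont (F i)) ->
  cintegral (@Q R) (fun x => \sum_(i <- r) F i x) =
  \sum_(i <- r) cintegral (@Q R) (F i).
Proof.
move=> cF; elim: r => [|i r IH].
  rewrite big_nil; under eq_cintegral do rewrite big_nil.
  rewrite /cintegral /re_fun /im_fun /=.
  by apply: complexP; rewrite /= Rintegral_cst ?mul0r//; exact: measurable_itv.
under eq_cintegral do rewrite big_cons.
by rewrite cintegralD ?IH ?big_cons//; exact: ccont_sum.
Qed.

Lemma normc_cintegral f k : ccont f -> (forall x, (@Q R) x -> normc (f x) <= k) ->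
  normc (cintegral (@Q R) f) <= 2 * k.
Proof.
move=> [rf jf] bf; apply: le_trans (normc_le_ReIm _) _ => /=.
have -> : 2 * k = k * (2^-1 - - 2^-1) + k * (2^-1 - - 2^-1) by field.
have h2 : - 2^-1 <= 2^-1 :> R by lra.
apply: lerD; apply: Rintegral_le_bound => // x xQ.
  by apply: le_trans (bf _ xQ); exact: (Re_le_normc (f x)).
by apply: le_trans (bf _ xQ); exact: (Im_le_normc (f x)).
Qed.

Lemma cintegral_wrap f (s : R) : 0 <= s < 1 -> ccont f ->
  (forall x, ~ (@Q R) x -> f x = 0) ->
  cintegral (@Q R) (fun x => f (x - s) + f (x - s + 1)) = cintegral (@Q R) f.
Proof.
move=> s01 [rf jf] fQ; rewrite /cintegral; apply: complexP => /=.
  under eq_Rintegral do rewrite /re_fun complex_ReD.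
  by apply: (Rintegral_wrap (f := re_fun f)) => // x /fQ; rewrite /re_fun => ->.
under eq_Rintegral do rewrite /im_fun complex_ImD.
by apply: (Rintegral_wrap (f := im_fun f)) => // x /fQ; rewrite /im_fun => ->.
Qed.

Lemma cintegral_dilate f (a : R) : 0 < a < 1 -> ccont f ->
  (forall x, ~ (@Q R) x -> f x = 0) ->
  cintegral (@Q R) (fun x => f (x / a)) = a%:C%C * cintegral (@Q R) f.
Proof.
move=> /andP[a0 a1] [rf jf] fQ.
have H (h : R -> R) : continuous h -> (forall x, ~ (@Q R) x -> h x = 0) ->
    \int[mu]_(x in @Q R) h (x / a) = a * \int[mu]_(x in @Q R) h x.
  move=> ch hQ.
  have ai : 0 < a^-1 by rewrite invr_gt0.
  have h2 : (- 2^-1 : R) <= 2^-1 by lra.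
  have := @Rintegral_affine R h a^-1 0 _ _ ai h2 ch.
  rewrite !addr0 => E.
  under eq_Rintegral do rewrite mulrC -[_ * _]addr0.
  apply: (mulfI (lt0r_neq0 ai)).
  rewrite mulrA mulVf ?lt0r_neq0// mul1r; apply: etrans; first exact: E.
  apply: (@Rintegral_supp2 _ _ (@Q R)) => // x.
  rewrite /Q/= !in_itv/= => /andP[? ?].
  have : 1 <= a^-1 by rewrite invf_ge1// ltW.
  by move: (a^-1) => b b1; apply/andP; split; nra.
rewrite /cintegral; apply: complexP; rewrite ?complex_ReM ?complex_ImM/= mul0r ?subr0 ?addr0.
  by apply: H => // x /fQ; rewrite /re_fun => ->.
by apply: H => // x /fQ; rewrite /im_fun => ->.
Qed.

End ComplexIntegrals.


(** * The convolution kernel of the multiplier *)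

Section Kernel.
Context {R : realType}.
Implicit Types (m f g : R -> R[i]) (u : int -> R[i]).

Lemma schwartz_ccont m : schwartz m -> ccont m.
Proof.
move=> [sm _]; split => x; apply/differentiable_continuous/derivable1_diffP.
  by have [] := sm 0%N x.
by have [] := sm 0%N x.
Qed.

Definition inverse_fourier m (y : R) : R[i] := cintegral (@Q R) (fun xi => m xi * e (y * xi)).

Definition dirichlet (N : nat) (x : int) : R[i] :=
  \sum_(s <- canonical_fractions N) e (s * x%:~R).

Lemma canonical_fractionsP (N : nat) (s : R) :
  reflect (exists q a : nat, [/\ (0 < q <= N)%N, (a < q)%N, coprime a q & s = a%:R / q%:R])
    (s \in canonical_fractions N).
Proof.
rewrite /canonical_fractions inE; apply: (iffP idP) => [/allpairsPdep[q [a]]|].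
  rewrite mem_iota mem_filter mem_iota add0n add1n ltnS => -[qN /andP[cop aq] ->].
  by exists q, a.
move=> [q [a [qN aq cop ->]]]; apply/allpairsPdep; exists q, a.
by rewrite mem_iota mem_filter mem_iota add0n add1n ltnS; split => //; apply/andP; split.
Qed.

Lemma canonical_fractions_itv (N : nat) (s : R) :
  s \in canonical_fractions N -> 0 <= s < 1.
Proof.
move=> /canonical_fractionsP[q [a [/andP[q0 _] aq _ ->]]].
have q0' : 0 < q%:R :> R by rewrite ltr0n.
by rewrite divr_ge0//= ltr_pdivrMr// mul1r ltr_nat.
Qed.

(** For a bump function strictly inside the period, periodization seen from Q
    is a sum of two translates. This removes the integer part, and with it the
    discontinuities, from the integrals below. *)
Lemma torus_shift g (x s : R) : (forall x, ~ `|x| < 2^-1 -> g x = 0) ->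
  (@Q R) x -> 0 <= s < 1 -> torus_fun g (x - s) = g (x - s) + g (x - s + 1).
Proof.
move=> gz; rewrite /Q/= in_itv/= => /andP[x1 x2] /andP[s0 s1].
rewrite /torus_fun.
have nlt (y : R) : (2^-1 <= y) || (y <= - 2^-1) -> g y = 0.
  by move=> /orP H; apply: gz; rewrite ltr_norml => /andP[? ?]; case: H; lra.
have [xs|xs] := ltP (x - s + 2^-1) 0.
  have -> : Num.floor (x - s + 2^-1) = -1.
    by apply/floor_def; rewrite (_ : (-1 + 1)%:~R = 0 :> R)// xs andbT rmorphN1; lra.
  rewrite (_ : (-1)%:~R = -1 :> R)// opprK (nlt (x - s)) ?add0r//.
  by apply/orP; right; lra.
have [xs1|xs1] := ltP (x - s + 2^-1) 1.
  have -> : Num.floor (x - s + 2^-1) = 0.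
    by apply/floor_def; rewrite xs/= add0r.
  rewrite subr0 (nlt (x - s + 1)) ?addr0//.
  by apply/orP; left; lra.
have xE : x = 2^-1 by lra.
have sE : s = 0 by lra.
rewrite xE sE subr0 (_ : 2^-1 + 2^-1 = 1 :> R); last by field.
rewrite floor1 (_ : 1%:~R = 1 :> R)// !nlt ?addr0//.
- by apply/orP; left; lra.
- by apply/orP; left; lra.
- by apply/orP; right; lra.
Qed.

(** Around one fraction s the frequency window is the window around 0
    translated by s, so its kernel is the kernel of the dilated bump modulated
    by the character of frequency s. *)
Lemma kernel_term m (a s : R) (k : int) : ccont m -> supported_on_Q m ->
  0 < a < 1 -> 0 <= s < 1 ->
  cintegral (@Q R) (fun xi => torus_fun (dilate m a) (xi - s) * e (k%:~R * xi)) =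
  e (k%:~R * s) * (a%:C%C * inverse_fourier m (a * k%:~R)).
Proof.
move=> cm mQ /[dup] a01 /andP[a0 a1] s01.
pose h xi := m xi * e (a * k%:~R * xi).
have ch : ccont h by apply: ccontM => //; exact: ccont_e.
have hQ x : ~ (@Q R) x -> h x = 0 by move=> nQ; rewrite /h mQ// mul0r.
pose g (xi : R) := h (a^-1 * xi + 0).
have gE xi : g xi = dilate m a xi * e (k%:~R * xi).
  rewrite /g /h /dilate addr0 (mulrC a^-1); congr (_ * e _).
  by field; rewrite gt_eqF.
have dz (x : R) : ~ `|x| < 2^-1 -> dilate m a x = 0.
  move=> xn; apply: mQ; rewrite /Q/= in_itv/= -ler_norml normrM normfV.
  rewrite (gtr0_norm a0) ler_pdivrMr//.
  by move/negP: xn; rewrite -leNgt => xn; apply/negP; rewrite -ltNge; nra.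
have gQ x : ~ (@Q R) x -> g x = 0.
  move=> nQ; rewrite gE dz ?mul0r// => /ltW; rewrite ler_norml => H.
  by apply: nQ; rewrite /Q/= in_itv.
transitivity (cintegral (@Q R) (fun xi => e (k%:~R * s) * (g (xi - s) + g (xi - s + 1)))).
  apply: eq_cintegral => x xQ; rewrite (torus_shift dz xQ s01) !gE.
  have -> : e (k%:~R * (x - s + 1)) = e (k%:~R * (x - s)).
    by rewrite mulrDr mulr1 eDint.
  rewrite -mulrDl mulrCA -eD; congr (_ * e _); ring.
have cg : ccont g := ccont_affine a^-1 0 ch.
rewrite cintegralZ; last first.
  apply: ccontD; first exact: ccont_shift.
  rewrite (_ : (fun x => g (x - s + 1)) = fun x => g (x + (1 - s))).
    exact: ccont_shift.
  by apply/funext => x; congr g; ring.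
congr (_ * _); rewrite cintegral_wrap// /g.
under eq_cintegral do rewrite addr0 mulrC.
by rewrite cintegral_dilate.
Qed.

(** The multiplier is a convolution: its kernel is the Dirichlet kernel of the
    canonical fractions times a slowly varying profile, the inverse Fourier
    transform of m at scale 1/a. *)
Lemma TZ_bracket m (a : R) (N : nat) (X : seq int) u (x : int) :
  ccont m -> supported_on_Q m -> 0 < a < 1 -> uniq X ->
  (forall y, y \notin X -> u y = 0) ->
  TZ (bracket (canonical_fractions N) (dilate m a)) u x =
  \sum_(y <- X) dirichlet N (x - y) * (a%:C%C * inverse_fourier m (a * (x - y)%:~R)) * u y.
Proof.
move=> cm mQ a01 uX uz.
have fE xi : fourierZ u xi = \sum_(y <- X) u y * e (- (y%:~R * xi)).
  rewrite /fourierZ (fsbigE X)//.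
    by apply: eq_bigl => i; rewrite in_setT.
  by move=> i _ /uz ->; rewrite mul0r.
pose S := canonical_fractions N : seq R.
rewrite /TZ.
have dz (z : R) : ~ `|z| < 2^-1 -> dilate m a z = 0.
  case/andP: a01 => a0 a1.
  move=> xn; apply: mQ; rewrite /Q/= in_itv/= -ler_norml normrM normfV.
  rewrite (gtr0_norm a0) ler_pdivrMr//.
  by move/negP: xn; rewrite -leNgt => xn; apply/negP; rewrite -ltNge; nra.
have cd : ccont (dilate m a).
  have := ccont_affine a^-1 0 cm.
  by under eq_fun do rewrite addr0 mulrC.
pose T' s y xi := (dilate m a (xi + - s) + dilate m a (xi + (1 - s))) * e ((x - y)%:~R * xi).
have cT' s y : ccont (T' s y).
  by apply: ccontM; [apply: ccontD; exact: ccont_shift|exact: ccont_e].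
transitivity (cintegral (@Q R) (fun xi => \sum_(y <- X) \sum_(s <- S) u y * T' s y xi)).
  apply: eq_cintegral => xi xQ; rewrite fE /bracket mulr_sumr mulr_suml.
  apply: eq_bigr => y _; rewrite !mulr_suml big_seq [RHS]big_seq; apply: eq_bigr => s sS.
  have s01 := canonical_fractions_itv sS.
  rewrite (torus_shift dz xQ s01) /T' -!mulrA mulrCA; congr (_ * _).
  rewrite -eD (addrC 1) addrA; congr (_ * e _).
  by rewrite rmorphB/=; ring.
rewrite cintegral_sum; last first.
  by move=> y; apply: ccont_sum => s; apply: ccontM; [exact: ccont_cst|exact: cT'].
apply: eq_bigr => y _.
rewrite cintegral_sum; last first.
  by move=> s; apply: ccontM; [exact: ccont_cst|exact: cT'].
rewrite /dirichlet mulrC mulr_suml mulr_sumr big_seq [RHS]big_seq.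
apply: eq_bigr => s sS; rewrite cintegralZ//; congr (_ * _).
have s01 := canonical_fractions_itv sS.
rewrite (mulrC s) -kernel_term//; apply: eq_cintegral => xi xQ.
by rewrite (torus_shift dz xQ s01) /T' (addrC 1) addrA.
Qed.

End Kernel.


(** * The inverse Fourier transform of the bump function *)

Section Injectivity.
Context {R : realType}.
Notation mu := (@lebesgue_measure R).
Implicit Types (m : R -> R[i]) (f : R -> R).

Lemma schwartz_bounded m : schwartz m -> exists2 B, 0 < B & forall x, normc (m x) <= B.
Proof.
move=> [_ /(_ 0%N 0%N)[B HB]]; exists (Num.max B 1).
  by rewrite lt_max ltr01 orbT.
move=> x; have := HB x; rewrite expr0 mul1r => H.
rewrite le_max; apply/orP; left; apply: le_trans H.
by rewrite /cderiv/= /re_fun /im_fun; case: (m x).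
Qed.

(** The frequencies of m lie in Q, so m has an inverse transform with bounded
    derivative. Hence at scale 1/eps it is nearly constant on periods much
    shorter than 1/eps. *)
Lemma inverse_fourier_lipschitz m : schwartz m ->
  exists2 L, 0 < L & forall x y, normc (inverse_fourier m x - inverse_fourier m y) <= L * `|x - y|.
Proof.
move=> sm; have [B B0 mB] := schwartz_bounded sm.
have cm := schwartz_ccont sm.
have pi0 := @pi_gt0 R.
exists (2 * (B * (4 * pi))); first by rewrite !mulr_gt0.
move=> x y.
have -> : inverse_fourier m x - inverse_fourier m y =
    cintegral (@Q R) (fun xi => m xi * (e (x * xi) + (-1) * e (y * xi))).
  rewrite /inverse_fourier -[in LHS]mulN1r -cintegralZ; last by apply: ccontM => //; exact: ccont_e.
  rewrite -cintegralD; last 2 first.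
  - by apply: ccontM => //; exact: ccont_e.
  - by apply: ccontM; [exact: ccont_cst|apply: ccontM => //; exact: ccont_e].
  by apply: eq_cintegral => xi _; ring.
rewrite -!mulrA; apply: normc_cintegral.
  apply: ccontM => //; apply: ccontD; first exact: ccont_e.
  by apply: ccontM; [exact: ccont_cst|exact: ccont_e].
move=> xi; rewrite /Q/= in_itv/= -ler_norml => xi1.
rewrite normcM mulN1r; apply: ler_pM => //; try exact: normc_ge0.
apply: le_trans (e_lipschitz _ _) _.
rewrite -mulrBl normrM -mulrA; apply: ler_wpM2l => //; apply: ler_wpM2l; first exact: ltW.
by rewrite -[leRHS]mulr1 ler_wpM2l//; lra.
Qed.

Lemma Rintegral_subset f (a b c d : R) : continuous f ->
  c <= a -> b <= d -> (forall x, x \in `[c, d] -> 0 <= f x) ->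
  \int[mu]_(x in `[a, b]) f x <= \int[mu]_(x in `[c, d]) f x.
Proof.
move=> cf ca bd f0.
have I x y : mu.-integrable `[x, y] (EFin \o f) by exact: integrable_cont.
have cfE x y : (\int[mu]_(x in `[x, y]) (f x)%:E)%E \is a fin_num.
  by apply: integrable_fin_num => //; exact: I.
rewrite /Rintegral fine_le//.
apply: ge0_subset_integral => //.
- by have /integrableP[] := I c d.
- by apply: subset_itv; rewrite bnd_simp.
Qed.

(** A trigonometric polynomial with its maximum on Q at x1. The half frequency
    makes it decrease with the distance to x1 up to distance 1, the diameter of
    Q; its powers concentrate at x1. *)
Definition peak (x1 x : R) : R := (1 + cos (pi * (x - x1))) / 2.

Lemma continuous_peak x1 : continuous (peak x1).
Proof.
have -> : peak x1 = fun x => (1 + cos (pi * x + - pi * x1)) / 2.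
  by apply/funext => x; rewrite /peak mulrBr mulNr.
move=> x; apply: cvgM; last exact: cvg_cst.
apply: cvgD; first exact: cvg_cst.
exact: (continuous_affine (@continuous_cos R)).
Qed.

Lemma peak_ge0 x1 x : 0 <= peak x1 x.
Proof. by rewrite /peak; have := cos_geN1 (pi * (x - x1)); lra. Qed.

Lemma peak_lt x1 x y : `|x - x1| < `|y - x1| <= 1 -> peak x1 y < peak x1 x.
Proof.
move=> /andP[xy y1]; rewrite /peak ltr_pM2r ?invr_gt0// ltrD2l.
have pi0 := @pi_gt0 R.
have cosE z : cos (pi * (z - x1)) = cos (pi * `|z - x1|).
  by rewrite -[in LHS]cos_norm normrM (gtr0_norm pi0).
rewrite !cosE ltr_cos ?ltr_pM2l// in_itv/= mulr_ge0 ?(ltW pi0)//= ger_pMr//.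
by rewrite ltW// (lt_le_trans xy).
Qed.

Lemma peak_le x1 x y : `|x - x1| <= `|y - x1| <= 1 -> peak x1 y <= peak x1 x.
Proof.
rewrite le_eqVlt => /andP[/orP[/eqP xy _|xy y1]]; last by rewrite ltW ?peak_lt ?xy.
rewrite /peak -[in leLHS]cos_norm -[in leRHS]cos_norm !normrM xy//.
Qed.

(** If f x1 were positive, f would be at least f x1 / 2 on a neighbourhood of
    x1. There the k-th power of the peak is at least al ^ k, while outside a
    slightly larger neighbourhood it is at most be ^ k with be < al, so for
    large k the contribution of the neighbourhood to the integral wins and the
    integral cannot vanish. *)
Lemma peak_power_separates f x1 : continuous f -> (forall x, ~ (@Q R) x -> f x = 0) ->
  (exists2 B, 0 < B & forall x, `|f x| <= B) ->
  (forall k, \int[mu]_(x in @Q R) (f x * peak x1 x ^+ k) = 0) -> ~ 0 < f x1.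
Proof.
move=> cf fQ [B B0 fB] f0 fx1.
have [d /andP[d0 d1] fd] : exists2 d, 0 < d < 1 & forall x, `|x - x1| < d -> f x1 / 2 <= f x.
  have := cf x1; move/cvgrPdist_lt => /(_ (f x1 / 2)).
  have fx12 : 0 < f x1 / 2 by rewrite divr_gt0.
  move=> /(_ fx12)[/= d d0 Hd].
  exists (Num.min d 2^-1); first by rewrite lt_min d0/= gt_min; apply/andP; split; [lra|apply/orP;right;lra].
  move=> x; rewrite lt_min => /andP[xd _].
  have : `|f x1 - f x| < f x1 / 2 by apply: Hd; rewrite /= distrC.
  rewrite ltr_norml => /andP[_]; lra.
have QP x : `|x - x1| < d -> (@Q R) x.
  move=> /fd H; apply: contrapT => /fQ fx0; move: H; rewrite fx0; lra.
have x1Q : (@Q R) x1 by apply: QP; rewrite subrr normr0.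
have dist1 x : (@Q R) x -> `|x - x1| <= 1.
  move: x1Q; rewrite /Q/= !in_itv/= => /andP[? ?] /andP[? ?].
  by rewrite ler_norml; apply/andP; split; lra.
pose al := peak x1 (x1 + d / 2); pose be := peak x1 (x1 + (d * 3/4)).
have nd (k : R) : 0 <= k -> `|x1 + k - x1| = k by move=> k0; rewrite addrC addKr ger0_norm.
have be0 : 0 <= be by exact: peak_ge0.
have albe : be < al.
  by apply: peak_lt; rewrite !nd; first apply/andP; try split; lra.
have al0 : 0 < al by exact: le_lt_trans albe.
suff H k : f x1 / 2 * d * al ^+ k <= B * be ^+ k.
  have /cvgrPdist_lt : (GRing.exp (be / al) : nat -> R) k @[k --> \oo] --> 0.
    by apply: cvg_expr; rewrite ger0_norm ?divr_ge0 ?(ltW al0)// ltr_pdivrMr// mul1r.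
  have c0 : 0 < f x1 / 2 * d / B by rewrite !mulr_gt0 ?invr_gt0.
  move=> /(_ _ c0)[k _ /(_ k (leqnn k))] /=.
  rewrite sub0r normrN ger0_norm; last by rewrite exprn_ge0// divr_ge0 ?(ltW al0).
  rewrite ltNge => /negP; apply; rewrite expr_div_n ler_pdivrMr// [leRHS]mulrAC ler_pdivlMr ?exprn_gt0//.
  by rewrite [leRHS]mulrC; exact: H.
(* adding the bound of the tail makes the integrand nonnegative *)
pose g x := f x * peak x1 x ^+ k + B * be ^+ k.
have cpk : continuous (fun x => peak x1 x ^+ k).
  move=> x; apply: (@continuous_comp _ _ _ (peak x1) (fun y => y ^+ k)).
    exact: continuous_peak.
  exact: exprn_continuous.
have cfk : continuous (fun x => f x * peak x1 x ^+ k).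
  by move=> x; apply: cvgM; [exact: cf|exact: cpk].
have cg : continuous g.
  by move=> x; apply: cvgD; [exact: cfk|exact: cvg_cst].
have ccst (c : R) : continuous (fun _ : R => c) by move=> x; exact: cst_continuous.
have gQ : \int[mu]_(x in @Q R) g x = B * be ^+ k.
  rewrite /g RintegralD//; [|exact: measurable_itv|exact: integrable_cont|exact: integrable_cont].
  rewrite f0 add0r Rintegral_cst; last exact: measurable_itv.
  rewrite /Q /= lebesgue_measure_itv/= lte_fin ifT; last by lra.
  by rewrite /= -[RHS]mulr1; congr (_ * _); field.
rewrite -gQ; apply: (@le_trans _ _ (\int[mu]_(x in `[x1 - d / 2, x1 + d / 2]) g x)).
  have -> : f x1 / 2 * d * al ^+ k =
      \int[mu]_(x in `[x1 - d / 2, x1 + d / 2]) (f x1 / 2 * al ^+ k).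
    rewrite Rintegral_cst//= lebesgue_measure_itv/= lte_fin ifT; last by lra.
    by rewrite /=; field.
  apply: le_Rintegral => //; [exact: integrable_cont..|].
  move=> x; rewrite /= in_itv/= => /andP[xd1 xd2].
  have xd : `|x - x1| <= d / 2 by rewrite ler_norml; apply/andP; split; lra.
  rewrite /g; apply: ler_wpDr; first by rewrite mulr_ge0 ?exprn_ge0 ?(ltW B0).
  apply: ler_pM; rewrite ?exprn_ge0 ?(ltW al0) ?divr_ge0 ?(ltW fx1)//.
    by apply: fd; lra.
  rewrite lerXn2r// ?nnegrE ?(ltW al0) ?peak_ge0//.
  by apply: peak_le; rewrite nd; [apply/andP; split|]; lra.
have := QP (x1 - d / 2); have := QP (x1 + d / 2).
rewrite nd; last lra.
rewrite addrAC subrr add0r normrN ger0_norm; last by lra.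
have dd : d / 2 < d by lra.
move=> /(_ dd); rewrite /Q/= !in_itv/= => /andP[_ r2] /(_ dd) /andP[r3 _].
apply: Rintegral_subset => // x xQ.
rewrite /g; have [xd|xd] := ltP `|x - x1| d.
  rewrite addr_ge0 ?mulr_ge0 ?exprn_ge0 ?peak_ge0 ?(ltW B0)//.
  by apply: le_trans (fd _ xd); rewrite divr_ge0 ?ltW.
rewrite -lerBlDr sub0r.
have : `|f x * peak x1 x ^+ k| <= B * be ^+ k.
  rewrite normrM (ger0_norm (_ : 0 <= peak _ _ ^+ _)) ?exprn_ge0 ?peak_ge0//.
  apply: ler_pM => //; rewrite ?exprn_ge0 ?peak_ge0//.
  rewrite lerXn2r// ?nnegrE ?peak_ge0//.
  apply: peak_le; rewrite nd; last by lra.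
  by rewrite dist1 // andbT; lra.
by rewrite ler_norml => /andP[].
Qed.

(** Injectivity of the Fourier transform on bump functions: multiplying by the
    peak only shifts frequencies by 1/2, so if the transform vanished
    identically, m would be orthogonal to all powers of all peaks. *)
Lemma inverse_fourier_neq0 m : schwartz m -> supported_on_Q m -> (exists x, m x != 0) ->
  exists y, inverse_fourier m y != 0.
Proof.
move=> sm mQ [x1 mx1]; apply: contrapT => H.
have M0 y : inverse_fourier m y = 0.
  by apply/eqP; apply: contrapT => /negP ?; apply: H; exists y.
have cm := schwartz_ccont sm.
have [B B0 mB] := schwartz_bounded sm.
have pkE xi : (peak x1 xi)%:C%C =
    (2^-1)%:C%C + (4^-1)%:C%C * (e (- x1 / 2) * e (2^-1 * xi) + e (x1 / 2) * e (- 2^-1 * xi)).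
  rewrite -!eD /e.
  have -> : 2 * pi * (- x1 / 2 + 2^-1 * xi) = pi * (xi - x1) by field.
  have -> : 2 * pi * (x1 / 2 + - 2^-1 * xi) = - (pi * (xi - x1)) by field.
  by rewrite cosN sinN; apply: complexP; rewrite /peak !(complex_ReD, complex_ImD, complex_ReM, complex_ImM)/=; [lra|ring].
have cpk : ccont (fun xi => (peak x1 xi)%:C%C).
  split; first exact: continuous_peak.
  by move=> x; exact: cst_continuous.
have F k : ccont (fun xi => m xi * (peak x1 xi)%:C%C ^+ k) /\
    forall y, cintegral (@Q R) (fun xi => m xi * (peak x1 xi)%:C%C ^+ k * e (y * xi)) = 0.
  elim: k => [|k [ck IH]].
    split; first by under eq_fun do rewrite expr0 mulr1.
    by move=> y; under eq_cintegral do rewrite expr0 mulr1; exact: M0.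
  split.
    by under eq_fun do rewrite exprSr mulrA; exact: ccontM.
  move=> y; pose h xi := m xi * (peak x1 xi)%:C%C ^+ k.
  have che z : ccont (fun xi => h xi * e (z * xi)).
    by apply: ccontM => //; exact: ccont_e.
  transitivity (cintegral (@Q R) (fun xi =>
     (2^-1)%:C%C * (h xi * e (y * xi)) +
     ((4^-1)%:C%C * e (- x1 / 2) * (h xi * e ((y + 2^-1) * xi)) +
      (4^-1)%:C%C * e (x1 / 2) * (h xi * e ((y - 2^-1) * xi))))).
    apply: eq_cintegral => xi _; rewrite exprSr mulrA -/(h xi) pkE.
    by rewrite !mulrDl !eD; ring.
  have cz (c : R[i]) z : ccont (fun xi => c * (h xi * e (z * xi))).
    by apply: ccontM; [exact: ccont_cst|exact: che].
  rewrite cintegralD//; last by apply: ccontD.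
  by rewrite cintegralD// !cintegralZ// !IH !mulr0 !addr0.
have G k : cintegral (@Q R) (fun xi => m xi * (peak x1 xi)%:C%C ^+ k) = 0.
  have [_ /(_ 0) <-] := F k; apply: eq_cintegral => xi _.
  by rewrite mul0r e0 mulr1.
have pkX xi k : (peak x1 xi)%:C%C ^+ k = (peak x1 xi ^+ k)%:C%C.
  by rewrite rmorphXn.
have [rm jm] := cm.
have GR k : \int[mu]_(x in @Q R) (re_fun m x * peak x1 x ^+ k) = 0.
  have := G k => /(congr1 (@complex.Re R)) /= <-.
  apply: eq_Rintegral => xi _; rewrite /re_fun pkX complex_ReM/=.
  by rewrite mulr0 subr0.
have GI k : \int[mu]_(x in @Q R) (im_fun m x * peak x1 x ^+ k) = 0.
  have := G k => /(congr1 (@complex.Im R)) /= <-.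
  apply: eq_Rintegral => xi _; rewrite /im_fun pkX complex_ImM/=.
  by rewrite mulr0 add0r.
have P f : continuous f -> (forall x, ~ (@Q R) x -> f x = 0) ->
    (forall x, `|f x| <= B) ->
    (forall k, \int[mu]_(x in @Q R) (f x * peak x1 x ^+ k) = 0) -> f x1 = 0.
  move=> cf fQ fB f0; apply/eqP; rewrite eq_le; apply/andP; split; rewrite leNgt; apply/negP.
    by apply: peak_power_separates f0 => //; exists B.
  rewrite -oppr_gt0; apply: (@peak_power_separates (fun x => - f x)).
  - by move=> x; apply: cvgN; exact: cf.
  - by move=> x /fQ ->; rewrite oppr0.
  - by exists B => // x; rewrite normrN.
  - move=> k; under eq_Rintegral do rewrite mulNr -mulN1r.
    rewrite RintegralZl ?f0 ?mulr0//; first exact: measurable_itv.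
    apply: integrable_cont => x; apply: cvgM; first exact: cf.
    apply: (@continuous_comp _ _ _ (peak x1) (fun y => y ^+ k)).
      exact: continuous_peak.
    exact: exprn_continuous.
move/eqP: mx1; apply; apply: complexP.
  apply: (P (re_fun m)) => //.
    by move=> x /mQ; rewrite /re_fun => ->.
  by move=> x; apply: le_trans (mB x); exact: Re_le_normc.
apply: (P (im_fun m)) => //.
  by move=> x /mQ; rewrite /im_fun => ->.
by move=> x; apply: le_trans (mB x); exact: Im_le_normc.
Qed.

End Injectivity.


(** * Lower bounds for operator norms by duality *)

Section Duality.
Context {R : realType}.
Implicit Types (u w : int -> R[i]).

(** By Young's inequality, after normalizing the left factor. *)
Lemma finite_hoelder (I : eqType) (r : seq I) (a b : I -> R) (p q : R) :
  0 < p -> 0 < q -> p^-1 + q^-1 = 1 ->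
  (forall i, 0 <= a i) -> (forall i, 0 <= b i) ->
  \sum_(i <- r) b i `^ q <= 1 ->
  \sum_(i <- r) a i * b i <= (\sum_(i <- r) a i `^ p) `^ p^-1.
Proof.
move=> p0 q0 pq a0 b0 b1.
set A := \sum_(i <- r) a i `^ p.
have A0 : 0 <= A by apply: sumr_ge0 => i _; exact: powR_ge0.
have pn0 : p != 0 by rewrite gt_eqF.
have [Az|An] := eqVneq A 0.
  rewrite Az powR0 ?invr_eq0// big_seq big1// => i ir.
  have /eqP : a i `^ p = 0.
    apply/eqP; rewrite eq_le powR_ge0 andbT -Az /A.
    rewrite (big_rem i)//= lerDl; apply: sumr_ge0 => j _; exact: powR_ge0.
  by rewrite powR_eq0 => /andP[/eqP -> _]; rewrite mul0r.
have Ap : 0 < A by rewrite lt_neqAle eq_sym An.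
set Z := A `^ p^-1.
have Z0 : 0 < Z by exact: powR_gt0.
have ZpA : Z `^ p = A by rewrite /Z -powRrM mulVf// powRr1.
rewrite -[leRHS]mulr1 -ler_pdivrMl// mulr_sumr.
apply: (@le_trans _ _ (\sum_(i <- r) ((Z^-1 * a i) `^ p / p + b i `^ q / q))).
  apply: ler_sum => i _; rewrite mulrA; apply: conjugate_powR => //.
  by rewrite mulr_ge0 ?invr_ge0 ?(ltW Z0).
rewrite big_split/= -!mulr_suml -pq; apply: lerD.
  rewrite ler_piMl ?invr_ge0 ?(ltW p0)//.
  under eq_bigr => i _ do rewrite powRM ?invr_ge0 ?(ltW Z0)//.
  rewrite -mulr_sumr -/A -powR_inv1 ?(ltW Z0)// -powRrM mulN1r powRN ZpA.
  by rewrite mulVf// gt_eqF.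
by rewrite ler_piMl ?invr_ge0 ?(ltW q0).
Qed.

Lemma lp_norm_supp p u (X : seq int) : 0 < p -> uniq X ->
  (forall x, x \notin X -> u x = 0) ->
  lp_norm p u = ((\sum_(x <- X) normc (u x) `^ p) `^ p^-1)%:E.
Proof.
move=> p0 uX ux; rewrite /lp_norm -poweR_EFin; congr (_ `^ _)%E.
transitivity (\esum_(x in [set` X]) (normc (u x) `^ p)%:E)%E.
  rewrite [RHS]esum_mkcond; apply: eq_esum => x _.
  case: ifPn => // xX; rewrite ux ?normc0 ?powR0 ?gt_eqF//.
  by apply: contra xX => ?; apply/mem_set.
rewrite esum_fset; [|exact: finite_seq|by move=> i _; rewrite lee_fin powR_ge0].
by rewrite -fsbig_seq// sumEFin.
Qed.

Lemma lp_norm_ge p u (X : seq int) : 0 < p -> uniq X ->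
  (((\sum_(x <- X) normc (u x) `^ p) `^ p^-1)%:E <= lp_norm p u)%E.
Proof.
move=> p0 uX; rewrite /lp_norm -poweR_EFin.
apply: gt0_ler_poweR; rewrite ?invr_ge0 ?(ltW p0)//.
- by rewrite in_itv/= leey andbT lee_fin sumr_ge0// => i _; exact: powR_ge0.
- by rewrite in_itv/= leey andbT esum_ge0// => i _; rewrite lee_fin powR_ge0.
apply: esum_ge; exists [set` X] => //.
  by split => //; exact: finite_seq.
by rewrite -fsbig_seq// sumEFin.
Qed.

Lemma lp_opnorm_ge_pairing p q (A : (int -> R[i]) -> int -> R[i]) u w
    (X Y : seq int) :
  0 < p -> 0 < q -> p^-1 + q^-1 = 1 -> uniq X -> uniq Y ->
  (forall x, x \notin X -> u x = 0) ->
  \sum_(x <- X) normc (u x) `^ p <= 1 ->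
  \sum_(y <- Y) normc (w y) `^ q <= 1 ->
  ((normc (\sum_(y <- Y) A u y * w y))%:E <= lp_opnorm p A)%E.
Proof.
move=> p0 q0 pq uX uY ux u1 w1.
apply: (@le_trans _ _ (lp_norm p (A u))); last first.
  apply: ereal_sup_ubound; exists u => //; split.
    apply: (@sub_finite_set _ _ [set` X]); last exact: finite_seq.
    move=> x /=; apply: contraR => /ux ->; exact: eqxx.
  rewrite (lp_norm_supp p0 uX ux) lee_fin (_ : 1 = 1 `^ p^-1); last by rewrite powR1.
  rewrite ge0_ler_powR ?invr_ge0 ?(ltW p0) ?nnegrE//.
  by apply: sumr_ge0 => i _; exact: powR_ge0.
apply: le_trans (lp_norm_ge (A u) p0 uY); rewrite lee_fin.
apply: le_trans (normc_sum _ _ _) _.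
under eq_bigr do rewrite normcM.
by apply: (@finite_hoelder _ _ _ _ _ q) => // i; exact: normc_ge0.
Qed.

End Duality.


(** * Transference from a period to the integers *)

Section Transference.
Context {R : realType}.
Implicit Types (m : R -> R[i]) (F G : int -> R[i]).

(** The test sequences on the integers are periodic functions cut off to a
    segment made of whole periods. *)
Definition segment (j : int) (L : nat) : seq int := [seq j + n%:Z | n <- iota 0 L].

Lemma segment_uniq j L : uniq (segment j L).
Proof. by rewrite map_inj_uniq ?iota_uniq// => a b /addrI []. Qed.

Lemma sum_segment (V : nmodType) (f : int -> V) (j : int) (K W : nat) :
  \sum_(x <- segment (j * W%:Z) (K * W)) f x =
  \sum_(a < K) \sum_(i < W) f ((j + a%:Z) * W%:Z + i%:Z).
Proof.
rewrite /segment big_map (_ : iota 0 _ = index_iota 0 (K * W)%N); last first.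
  by rewrite /index_iota subn0.
elim: K => [|K IH]; first by rewrite mul0n big_ord0 big_geq.
rewrite mulSnr (@big_cat_nat _ _ _ (K * W)%N)/= ?leq_addr// IH big_ord_recr/=.
congr (_ + _); rewrite -{1}[(K * W)%N]add0n big_addn addKn big_mkord.
apply: eq_bigr => i _; congr f.
by rewrite PoszD PoszM mulrDl (addrC i%:Z) addrA.
Qed.

Definition zperiodic (W : nat) (T : Type) (F : int -> T) := forall x, F (x + W%:Z) = F x.

Lemma zperiodicM W T (F : int -> T) : zperiodic W F ->
  forall (k : int) x, F (k * W%:Z + x) = F x.
Proof.
move=> FW; have H (n : nat) x : F (n%:Z * W%:Z + x) = F x.
  elim: n x => [|n IH] x; first by rewrite mul0r add0r.
  by rewrite -addn1 PoszD mulrDl mul1r -addrA IH addrC FW.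
case=> n x; first exact: H.
by rewrite NegzE mulNr -[LHS](H n.+1) addNKr.
Qed.

Lemma dirichlet_periodic (N W : nat) : (forall d, (0 < d <= N)%N -> (d %| W)%N) ->
  zperiodic W (@dirichlet R N).
Proof.
move=> dW x; rewrite /dirichlet big_seq [RHS]big_seq; apply: eq_bigr => s.
move=> /canonical_fractionsP[q [a [qN aq cop ->]]].
have /dvdnP[k kE] := dW q qN.
have q0 : q%:R != 0 :> R by rewrite pnatr_eq0; case: q qN {aq cop kE}.
rewrite rmorphD/= mulrDr kE -[RHS](@eDint R _ (a * k)%N%:Z); congr (e (_ + _)).
by rewrite -!pmulrn !natrM; field.
Qed.

Lemma sum_powR_segment F (p : R) (j : int) (K W : nat) :
  zperiodic W F ->
  \sum_(x <- segment (j * W%:Z) (K * W)) normc (F x) `^ p =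
  K%:R * \sum_(i < W) normc (F i%:Z) `^ p.
Proof.
move=> FW; rewrite sum_segment.
under eq_bigr => a _ do under eq_bigr => i _ do rewrite (zperiodicM FW).
by rewrite sumr_const card_ord mulr_natl.
Qed.

(** The sum is over K by K blocks of side W. The profile M varies by at most
    L d / K inside a block, so a block contributes M at its corner times the
    sum over one period, up to an error that is negligible once K is large
    compared with the sum of the moduli over a period. At all corners M is
    within M0 / 2 of its value at y0, so the blocks add up without
    cancellation. *)
Lemma block_sum_ge (M : R -> R[i]) (L M0 y0 d : R) (K W : nat) (j : int)
    (D : 'I_W -> 'I_W -> R[i]) :
  (forall x y, normc (M x - M y) <= L * `|x - y|) ->
  0 < L -> 0 < d -> (0 < K)%N -> (0 < W)%N -> normc (M y0) = M0 -> 4 * L * d = M0 ->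
  `|d / K%:R * j%:~R - y0| <= d ->
  4 * L * d * (\sum_(i < W) \sum_(i' < W) normc (D i i')) <=
    K%:R * M0 * normc (\sum_(i < W) \sum_(i' < W) D i i') ->
  K%:R ^+ 2 * (M0 * normc (\sum_(i < W) \sum_(i' < W) D i i') / 4) <=
  normc (\sum_(b < K) \sum_(i < W) \sum_(a < K) \sum_(i' < W)
    D i i' * M (d / (K * W)%:R * ((j + b%:Z - a%:Z) * W%:Z + i%:Z - i'%:Z)%:~R)).
Proof.
move=> ML L0 d0 K0 W0 My0 dE jy0 Csmall.
set P := \sum_(i < W) \sum_(i' < W) D i i' in Csmall *.
set C := \sum_(i < W) \sum_(i' < W) normc (D i i') in Csmall.
have K0' : 0 < K%:R :> R by rewrite ltr0n.
have W0' : 0 < W%:R :> R by rewrite ltr0n.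
under eq_bigr => b _ do rewrite exchange_big/=.
set S := \sum_(b < K) _.
have Z (b a : 'I_K) : normc (P * M y0 - \sum_(i < W) \sum_(i' < W)
    D i i' * M (d / (K * W)%:R * ((j + b%:Z - a%:Z) * W%:Z + i%:Z - i'%:Z)%:~R)) <=
    3 / 4 * (M0 * normc P).
  (* the corner of the block (b, a) *)
  pose T := d / K%:R * (j + b%:Z - a%:Z)%:~R.
  have -> : P * M y0 - \sum_(i < W) \sum_(i' < W)
      D i i' * M (d / (K * W)%:R * ((j + b%:Z - a%:Z) * W%:Z + i%:Z - i'%:Z)%:~R) =
      P * (M y0 - M T) + \sum_(i < W) \sum_(i' < W)
      D i i' * (M T - M (T + d / (K * W)%:R * (i%:Z - i'%:Z)%:~R)).
    rewrite mulrBr -[RHS]addrA; congr (_ + _).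
    rewrite /P mulr_suml -!sumrN -big_split/=; apply: eq_bigr => i _.
    rewrite mulr_suml -!sumrN -big_split/=; apply: eq_bigr => i' _.
    rewrite mulrBr addrA addNr add0r; congr (- (_ * M _)).
    rewrite /T natrM !(rmorphD, rmorphB, rmorphM, rmorphN)/= -!pmulrn.
    by field; rewrite !gt_eqF.
  apply: le_trans (le_normcD _ _) _.
  have ba : `|b%:R - a%:R| <= K%:R :> R.
    have bK : b%:R <= K%:R :> R by rewrite ler_nat ltnW.
    have aK : a%:R <= K%:R :> R by rewrite ler_nat ltnW.
    have b0 : 0 <= b%:R :> R by [].
    have a0 : 0 <= a%:R :> R by [].
    by rewrite ler_norml; apply/andP; split; lra.
  have e1 : normc (P * (M y0 - M T)) <= M0 / 2 * normc P.
    rewrite normcM mulrC ler_wpM2r ?normc_ge0//.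
    apply: le_trans (ML _ _) _.
    rewrite (_ : M0 / 2 = L * (d + d)); last by rewrite -dE; field.
    rewrite ler_pM2l// distrC.
    have -> : T - y0 = (d / K%:R * j%:~R - y0) + d / K%:R * (b%:R - a%:R).
      by rewrite /T !(rmorphD, rmorphB, rmorphN)/= -!pmulrn; ring.
    apply: le_trans (ler_normD _ _) _; apply: lerD => //.
    rewrite normrM ger0_norm ?divr_ge0 ?(ltW d0)//.
    by rewrite [leLHS]mulrAC ler_pdivrMr// ler_pM2l.
  have e2 : normc (\sum_(i < W) \sum_(i' < W)
      D i i' * (M T - M (T + d / (K * W)%:R * (i%:Z - i'%:Z)%:~R))) <= M0 * normc P / 4.
    have : C * (L * (d / K%:R)) <= M0 * normc P / 4.
      rewrite (_ : C * (L * (d / K%:R)) = 4 * L * d * C / K%:R / 4); last by field; rewrite gt_eqF.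
      rewrite ler_pM2r ?invr_gt0// ler_pdivrMr//.
      by rewrite (_ : _ * K%:R = K%:R * M0 * normc P)//; ring.
    apply: le_trans.
    rewrite /C mulr_suml; apply: le_trans (normc_sum _ _ _) _; apply: ler_sum => i _.
    rewrite mulr_suml; apply: le_trans (normc_sum _ _ _) _; apply: ler_sum => i' _.
    rewrite normcM ler_wpM2l ?normc_ge0//; apply: le_trans (ML _ _) _.
    rewrite ler_pM2l// opprD addrA subrr add0r normrN normrM ger0_norm ?divr_ge0 ?(ltW d0)//.
    rewrite natrM invfM mulrA -[leRHS]mulr1 -[leLHS]mulrA ler_pM2l ?divr_gt0//.
    rewrite mulrC ler_pdivrMr// mul1r rmorphB/= -!pmulrn.
    have iW : i%:R <= W%:R :> R by rewrite ler_nat ltnW.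
    have iW' : i'%:R <= W%:R :> R by rewrite ler_nat ltnW.
    have i0 : 0 <= i%:R :> R by [].
    have i0' : 0 <= i'%:R :> R by [].
    by rewrite ler_norml; apply/andP; split; lra.
  by apply: le_trans (lerD e1 e2) _; lra.
have H : normc ((K ^ 2)%:R * (P * M y0) - S) <= K%:R ^+ 2 * (3 / 4 * (M0 * normc P)).
  have -> : (K ^ 2)%:R * (P * M y0) = \sum_(b < K) \sum_(a < K) P * M y0.
    by rewrite !sumr_const card_ord -mulrnA mulr_natl.
  rewrite /S -sumrB; apply: le_trans (normc_sum _ _ _) _.
  apply: (@le_trans _ _ (\sum_(b < K) K%:R * (3 / 4 * (M0 * normc P)))); last first.
    by rewrite sumr_const card_ord -[leLHS]mulr_natl mulrA -expr2.
  apply: ler_sum => b _; rewrite -sumrB; apply: le_trans (normc_sum _ _ _) _.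
  apply: (@le_trans _ _ (\sum_(a < K) (3 / 4 * (M0 * normc P)))); last first.
    by rewrite sumr_const card_ord -[leLHS]mulr_natl.
  by apply: ler_sum => a _; exact: Z.
have N : normc ((K ^ 2)%:R * (P * M y0)) = K%:R ^+ 2 * (M0 * normc P).
  rewrite !normcM My0 (mulrC (normc P)) -natrX; congr (_ * _).
  by rewrite -(rmorph_nat (real_complex R)) normc_real ger0_norm.
have := normcB_le ((K ^ 2)%:R * (P * M y0)) ((K ^ 2)%:R * (P * M y0) - S).
rewrite opprB addrCA subrr addr0 N => ?.
by lra.
Qed.

Lemma normalized_segment F (p A : R) (j : int) (K W : nat) :
  0 < p -> 0 < A -> (0 < K)%N -> (0 < W)%N -> zperiodic W F ->
  \sum_(i < W) normc (F i%:Z) `^ p <= W%:R * A ->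
  \sum_(x <- segment (j * W%:Z) (K * W))
     normc ((((K * W)%:R * A) `^ (- p^-1))%:C%C * F x) `^ p <= 1.
Proof.
move=> p0 A0 K0 W0 FW FA.
have KWA : 0 < (K * W)%:R * A by rewrite mulr_gt0// ltr0n muln_gt0 K0.
set c := _ `^ (- p^-1).
have c0 : 0 <= c by exact: powR_ge0.
under eq_bigr do rewrite normcM normc_real (ger0_norm c0) powRM ?normc_ge0//.
rewrite -mulr_sumr sum_powR_segment//.
have -> : c `^ p = ((K * W)%:R * A)^-1.
  by rewrite /c -powRrM mulNr mulVf ?gt_eqF// powR_inv1// ltW.
rewrite ler_pdivrMl// mulr1 natrM -mulrA ler_wpM2l//.
Qed.

(** The multiplier on the integers is at least as bad as convolution with the
    Dirichlet kernel on Z/W, up to a factor that depends on the bump function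
    alone. Two periodic functions, cut off to segments of K periods, are paired
    with the multiplier of width eps = d / (K W): the profile is then nearly
    constant over a period, while over the two segments it stays close to its
    value at a point y0 where it does not vanish. The second segment is shifted
    by about y0 / eps for that purpose. Letting K grow makes the errors
    negligible and eps as small as required. *)
Theorem transference m : schwartz m -> supported_on_Q m -> (exists x, m x != 0) ->
  exists2 kap : R, 0 < kap &
  forall (p q A B th : R) (N W : nat) F G,
  0 < p -> 0 < q -> p^-1 + q^-1 = 1 -> 0 < A -> 0 < B -> 0 < th -> (0 < W)%N ->
  (forall d, (0 < d <= N)%N -> (d %| W)%N) -> zperiodic W F -> zperiodic W G ->
  \sum_(i < W) normc (F i%:Z) `^ p <= W%:R * A ->
  \sum_(i < W) normc (G i%:Z) `^ q <= W%:R * B ->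
  let P := \sum_(i < W) \sum_(i' < W) dirichlet N (i%:Z - i'%:Z) * F i'%:Z * G i%:Z in
  P != 0 ->
  exists eps, 0 < eps <= th /\
   ((kap * (normc P / W%:R ^+ 2) / (A `^ p^-1 * B `^ q^-1))%:E <=
     lp_opnorm p (TZ (bracket (canonical_fractions N) (dilate m eps))))%E.
Proof.
move=> sm mQ mn0; have [y0 My0] := inverse_fourier_neq0 sm mQ mn0.
have [L L0 ML] := inverse_fourier_lipschitz sm; have cm := schwartz_ccont sm.
pose M0 := normc (inverse_fourier m y0).
have M00 : 0 < M0.
  rewrite lt_neqAle normc_ge0 andbT eq_sym.
  by apply: contra My0 => /eqP/eq0_normc ->.
have [d d0 dE] : exists2 d, 0 < d & 4 * L * d = M0.
  exists (M0 / (4 * L)); first by rewrite divr_gt0 ?mulr_gt0.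
  by field; rewrite gt_eqF.
exists (d * (M0 / 4)); first by rewrite mulr_gt0 ?divr_gt0.
move=> p q A B th N W F G p0 q0 pq A0 B0 th0 W0 NW FW GW FA GB P Pn0.
pose D (i i' : 'I_W) := dirichlet N (i%:Z - i'%:Z) * F i'%:Z * G i%:Z.
have PE : P = \sum_(i < W) \sum_(i' < W) D i i' by [].
pose C := \sum_(i < W) \sum_(i' < W) normc (D i i').
have P0 : 0 < normc P.
  rewrite lt_neqAle normc_ge0 andbT eq_sym.
  by apply: contra Pn0 => /eqP/eq0_normc ->.
have W0' : 0 < W%:R :> R by rewrite ltr0n.
(* K must exceed three thresholds: eps <= th, eps < 1 and small block error *)
pose X1 := d / th + 2 * d + 4 * L * d * C / (M0 * normc P).
have C0 : 0 <= C.
  by apply: sumr_ge0 => i _; apply: sumr_ge0 => i' _; exact: normc_ge0.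
have t1 : 0 < d / th by rewrite divr_gt0.
have t3 : 0 <= 4 * L * d * C / (M0 * normc P).
  by rewrite dE; apply: divr_ge0; apply: mulr_ge0 => //; exact: ltW.
pose K := (Num.truncn X1).+1.
have KX : X1 < K%:R by exact: truncnS_gt.
have K0 : (0 < K)%N by [].
have K0' : 0 < K%:R :> R by rewrite ltr0n.
have KW0 : 0 < (K * W)%:R :> R by rewrite ltr0n muln_gt0 K0.
have KKW : K%:R <= (K * W)%:R :> R by rewrite ler_nat leq_pmulr.
pose eps := d / (K * W)%:R.
have eps0 : 0 < eps by rewrite divr_gt0.
have eps1 : eps < 1.
  by rewrite /eps ltr_pdivrMr// mul1r; rewrite /X1 in KX; lra.
exists eps; split.
  rewrite eps0/= /eps ler_pdivrMr// mulrC -ler_pdivrMr//.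
  by rewrite /X1 in KX; lra.
(* the shift, in periods, that brings the differences x - y near y0 / eps *)
pose j := Num.floor (y0 * K%:R / d).
have jy0 : `|d / K%:R * j%:~R - y0| <= d.
  have := floor_itv (y0 * K%:R / d); rewrite -/j rmorphD/= (_ : 1%:~R = 1)// => /andP[j1 j2].
  have -> : d / K%:R * j%:~R - y0 = d / K%:R * (j%:~R - y0 * K%:R / d).
    by field; rewrite !gt_eqF.
  rewrite normrM ger0_norm ?divr_ge0 ?(ltW d0)// mulrAC ler_pdivrMr// ler_pM2l//.
  apply: (@le_trans _ _ 1); last by rewrite ler1n.
  by rewrite ler_norml; apply/andP; split; lra.
pose X := segment (0 * W%:Z) (K * W); pose Y := segment (j * W%:Z) (K * W).
pose c1 := ((K * W)%:R * A) `^ (- p^-1).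
pose c2 := ((K * W)%:R * B) `^ (- q^-1).
pose u x := if x \in X then c1%:C%C * F x else 0.
pose w y := c2%:C%C * G y.
have uX x : x \notin X -> u x = 0 by rewrite /u => /negbTE ->.
have u1 : \sum_(x <- X) normc (u x) `^ p <= 1.
  rewrite big_seq (eq_bigr (fun x => normc (c1%:C%C * F x) `^ p)); last first.
    by move=> x xX; rewrite /u xX.
  by rewrite -big_seq; exact: normalized_segment.
have w1 : \sum_(y <- Y) normc (w y) `^ q <= 1 by exact: normalized_segment.
have := @lp_opnorm_ge_pairing R p q (TZ (bracket (canonical_fractions N) (dilate m eps)))
  u w X Y p0 q0 pq (segment_uniq _ _) (segment_uniq _ _) uX u1 w1.
apply: le_trans; rewrite lee_fin.
have eps01 : 0 < eps < 1 by rewrite eps0.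
under eq_bigr do rewrite (TZ_bracket _ _ cm mQ eps01 (segment_uniq _ _) uX).
rewrite sum_segment.
have DW := dirichlet_periodic NW.
have -> : \sum_(b < K) \sum_(i < W)
    (\sum_(x <- X) dirichlet N ((j + b%:Z) * W%:Z + i%:Z - x) *
      (eps%:C%C * inverse_fourier m (eps * ((j + b%:Z) * W%:Z + i%:Z - x)%:~R)) * u x) *
       w ((j + b%:Z) * W%:Z + i%:Z) =
    (c1 * c2 * eps)%:C%C * \sum_(b < K) \sum_(i < W) \sum_(a < K) \sum_(i' < W)
    D i i' * inverse_fourier m (d / (K * W)%:R * ((j + b%:Z - a%:Z) * W%:Z + i%:Z - i'%:Z)%:~R).
  rewrite mulr_sumr; apply: eq_bigr => b _.
  rewrite mulr_sumr; apply: eq_bigr => i _.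
  rewrite mulr_suml big_seq.
  rewrite (eq_bigr (fun x => dirichlet N ((j + b%:Z) * W%:Z + i%:Z - x) *
      (eps%:C%C * inverse_fourier m (eps * ((j + b%:Z) * W%:Z + i%:Z - x)%:~R)) * (c1%:C%C * F x) *
       w ((j + b%:Z) * W%:Z + i%:Z))); last by move=> x xX; rewrite /u xX.
  rewrite -big_seq sum_segment mulr_sumr; apply: eq_bigr => a _.
  rewrite mulr_sumr; apply: eq_bigr => i' _.
  have -> : (j + b%:Z) * W%:Z + i%:Z - ((0 + a%:Z) * W%:Z + i'%:Z) =
    (j + b%:Z - a%:Z) * W%:Z + (i%:Z - i'%:Z) by ring.
  rewrite (zperiodicM DW) !(zperiodicM FW) /w !(zperiodicM GW) addrA.
  by rewrite /D !rmorphM/= -/eps; ring.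
rewrite normcM normc_real ger0_norm; last first.
  by rewrite !mulr_ge0 ?powR_ge0// ltW.
have small : 4 * L * d * C <= K%:R * M0 * normc P.
  have MP : 0 < M0 * normc P by rewrite mulr_gt0.
  by rewrite -[leRHS]mulrA -ler_pdivrMr//; rewrite /X1 in KX; lra.
have := block_sum_ge ML L0 d0 K0 W0 (erefl M0) dE jy0 small.
rewrite -PE => BS.
have cc : 0 <= c1 * c2 * eps by rewrite !mulr_ge0 ?powR_ge0// ltW.
apply: le_trans (ler_wpM2l cc BS).
have -> : c1 * c2 = ((K * W)%:R * (A `^ p^-1 * B `^ q^-1))^-1.
  rewrite /c1 /c2 !powRM ?(ltW KW0) ?(ltW A0) ?(ltW B0)//.
  rewrite mulrACA -powRD; last by rewrite (gt_eqF KW0) implybT.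
  rewrite -opprD pq powR_inv1 ?(ltW KW0)// !powRN.
  by rewrite -invfM -invfM.
have Ap : 0 < A `^ p^-1 by exact: powR_gt0.
have Bq : 0 < B `^ q^-1 by exact: powR_gt0.
rewrite le_eqVlt; apply/orP; left; apply/eqP; rewrite /eps natrM.
by field; rewrite !gt_eqF.
Qed.

End Transference.


(** * Sums over a period and the Chinese remainder theorem *)

Section CRT.

Lemma sum_zperiodic (V : nmodType) (f : int -> V) (K W : nat) : zperiodic W f ->
  \sum_(i < K * W) f i%:Z = (\sum_(i < W) f i%:Z) *+ K.
Proof.
move=> fW; have := sum_segment f 0 K W.
under [RHS]eq_bigr => a _ do under eq_bigr => i _ do rewrite (zperiodicM fW).
rewrite sumr_const card_ord => <-.
rewrite /segment big_map -(big_mkord xpredT (fun i => f i%:Z)) /index_iota subn0.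
by apply: eq_bigr => i _; rewrite mul0r add0r.
Qed.

(** Group the residues modulo a b by their residue modulo a; inside a group the
    residues modulo b are all met once because a is invertible modulo b. *)
Lemma sum_coprime (K : comPzRingType) (a b : nat) (f g : int -> K) :
  (0 < b)%N -> coprime a b -> zperiodic a f -> zperiodic b g ->
  \sum_(x < a * b) f x%:Z * g x%:Z = (\sum_(x < a) f x%:Z) * (\sum_(x < b) g x%:Z).
Proof.
move=> b0 cab fa gb.
have := sum_segment (fun x => f x * g x) 0 b a.
rewrite /segment big_map mul0r (mulnC b) => H.
transitivity (\sum_(j <- iota 0 (a * b)) f (0 + j%:Z) * g (0 + j%:Z)).
  rewrite -(big_mkord xpredT (fun i => f i%:Z * g i%:Z)) /index_iota subn0.
  by apply: eq_bigr => i _; rewrite add0r.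
rewrite {}H exchange_big/= mulr_suml; apply: eq_bigr => i _.
under eq_bigr => k _ do rewrite (zperiodicM fa).
rewrite -mulr_sumr; congr (_ * _).
pose h (k : 'I_b) := Ordinal (ltn_pmod (k * a + i) b0).
have h_inj : injective h.
  move=> k k' /(congr1 val)/= /eqP.
  rewrite eqn_modDr => /eqP kk'; apply/val_inj => /=.
  have := kk'; move/eqP; rewrite ![(_ * a)%N]mulnC.
  wlog le : k k' {kk'} / (k <= k')%N.
    move=> H; case: (leqP k k') => [/H//|/ltnW kk]; rewrite eq_sym => /H -> //.
  rewrite eq_sym eqn_mod_dvd ?leq_mul2l ?le ?orbT// -mulnBr Gauss_dvdr; last by rewrite coprime_sym.
  have lt : (k' - k < b)%N by rewrite (leq_ltn_trans (leq_subr _ _)).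
  move=> dv; apply/eqP; rewrite eqn_leq le/= -subn_eq0.
  by case: (posnP (k' - k)%N) => [//|p0]; have := dvdn_leq p0 dv; rewrite leqNgt lt.
rewrite [RHS](reindex_inj h_inj)/=; apply: eq_bigr => k _.
rewrite add0r -PoszM -PoszD [in LHS](divn_eq (k * a + i) b) PoszD PoszM.
by rewrite (zperiodicM gb).
Qed.

Lemma zperiodic_mul W T (F : int -> T) k : zperiodic W F -> zperiodic (k * W) F.
Proof. by move=> FW x; rewrite addrC PoszM (zperiodicM FW). Qed.

Lemma zperiodic_dvd V W T (F : int -> T) : (W %| V)%N -> zperiodic W F -> zperiodic V F.
Proof. by move=> /dvdnP[k ->]; exact: zperiodic_mul. Qed.

Lemma zperiodic_prod (K : comPzRingType) (I : eqType) (r : seq I) (q : I -> nat)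
    (f : I -> int -> K) : (forall i, zperiodic (q i) (f i)) ->
  zperiodic (\prod_(i <- r) q i) (fun x => \prod_(i <- r) f i x).
Proof.
move=> fq; elim: r => [|i r IH] x; first by rewrite !big_nil.
rewrite !big_cons; congr (_ * _).
  by rewrite mulnC (zperiodic_mul _ (fq i)).
exact: (zperiodic_mul _ IH).
Qed.

Definition pairwise_coprime (I : eqType) (q : I -> nat) :=
  forall i j, i != j -> coprime (q i) (q j).

Lemma coprime_prod_seq (I : eqType) (r : seq I) (q : I -> nat) (i : I) :
  pairwise_coprime q -> i \notin r -> coprime (q i) (\prod_(j <- r) q j).
Proof.
move=> cq; elim: r => [|j r IH]; first by rewrite big_nil coprimen1.
rewrite inE negb_or big_cons => /andP[ij ir].
by rewrite coprimeMr cq// IH.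
Qed.

Lemma sum_prod_coprime (K : comPzRingType) (I : eqType) (r : seq I) (q : I -> nat)
    (f : I -> int -> K) :
  uniq r -> (forall i, 0 < q i)%N -> pairwise_coprime q ->
  (forall i, zperiodic (q i) (f i)) ->
  \sum_(x < \prod_(i <- r) q i) \prod_(i <- r) f i x%:Z =
  \prod_(i <- r) \sum_(x < q i) f i x%:Z.
Proof.
move=> + q0 cq fq; elim: r => [|i r IH]/= => [_|/andP[ir ur]].
  by rewrite !big_nil big_ord1 big_nil.
rewrite !big_cons; under eq_bigr do rewrite big_cons.
rewrite (@sum_coprime _ _ _ (f i) (fun x => \prod_(j <- r) f j x)) ?IH//.
- by rewrite prodn_gt0.
- exact: coprime_prod_seq.
- exact: zperiodic_prod.
Qed.

End CRT.


(** * The Dirichlet kernel acting on Riesz products *)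

Section Pairing.
Context {R : realType}.
Local Notation C := R[i].

Lemma e_neq1_nint (t : R) : ~ (exists k : int, t = k%:~R) -> e t != 1.
Proof.
move=> tn; rewrite (_ : e t = e (t - (Num.floor t)%:~R)); last first.
  by rewrite -[RHS](eDint _ (Num.floor t)) subrK.
apply: e_neq1; have := floor_itv t; rewrite rmorphD/= (_ : 1%:~R = 1)// => /andP[t1 t2].
apply/andP; split; last by lra.
rewrite lt_neqAle subr_ge0 t1 andbT eq_sym subr_eq0; apply/eqP => tE.
by apply: tn; exists (Num.floor t).
Qed.

Lemma e_mulrn (t : R) (n : nat) : e (t * n%:R) = e t ^+ n.
Proof.
elim: n => [|n IH]; first by rewrite mulr0 e0.
by rewrite -addn1 natrD mulrDr mulr1 eD IH exprD expr1.
Qed.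

Lemma sum_e_nint (t : R) (W : nat) : (exists k : int, t * W%:R = k%:~R) ->
  ~ (exists k : int, t = k%:~R) -> \sum_(y < W) e (t * y%:Z%:~R) = 0.
Proof.
move=> [k tW] tn; have := e_neq1_nint tn; rewrite -subr_eq0 => t1.
apply: (mulfI t1); rewrite mulr0.
under eq_bigr do rewrite -?pmulrn e_mulrn.
by rewrite -subrX1 -e_mulrn tW e_int subrr.
Qed.

Lemma ratio_int (b : int) (d W : nat) : (0 < d)%N -> (d %| W)%N ->
  exists k : int, b%:~R / d%:R * W%:R = k%:~R :> R.
Proof.
move=> d0 /dvdnP[k ->]; exists (b * k%:Z).
by rewrite natrM intrM -pmulrn; field; rewrite pnatr_eq0 -lt0n.
Qed.

Lemma canonical_fraction_eq (q d a : nat) (b k : int) :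
  coprimez b d -> (0 < d)%N -> coprime a q -> (0 < q)%N ->
  b%:~R / d%:R - a%:R / q%:R = k%:~R :> R -> d = q.
Proof.
move=> cbd d0 caq q0 /(congr1 (fun z => z * (d%:R * q%:R))).
have dn : d%:R != 0 :> R by rewrite pnatr_eq0 -lt0n.
have qn : q%:R != 0 :> R by rewrite pnatr_eq0 -lt0n.
have -> : (b%:~R / d%:R - a%:R / q%:R) * (d%:R * q%:R) = (b * q%:Z - a%:Z * d%:Z)%:~R :> R.
  by rewrite intrB !intrM -!pmulrn; field; rewrite dn qn.
have -> : k%:~R * (d%:R * q%:R) = (k * d%:Z * q%:Z)%:~R :> R.
  by rewrite !intrM -!pmulrn mulrA.
move=> /eqP; rewrite eqr_int => /eqP E.
apply/eqP; rewrite eqn_dvd; apply/andP; split.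
  have : (d%:Z %| b * q%:Z)%Z.
    apply/dvdzP; exists (k * q%:Z + a%:Z).
    by move/eqP: E; rewrite subr_eq => /eqP ->; ring.
  by rewrite Gauss_dvdzr// coprimez_sym.
have : (q%:Z %| a%:Z * d%:Z)%Z.
  apply/dvdzP; exists (b - k * d%:Z).
  by move/eqP: E; rewrite subr_eq addrC -subr_eq => /eqP <-; ring.
by rewrite Gauss_dvdzr// coprimezE/= coprime_sym.
Qed.

(** Convolution with the Dirichlet kernel keeps a character of exact denominator
    d when d <= N, because then its frequency is congruent modulo 1 to one
    canonical fraction, and kills it otherwise. *)
Lemma dirichlet_char (N W d : nat) (b x : int) :
  coprimez b d -> (0 < d)%N -> (d %| W)%N -> (forall q, (0 < q <= N)%N -> (q %| W)%N) ->
  \sum_(y < W) dirichlet N (x - y%:Z) * e (b%:~R / d%:R * y%:Z%:~R) =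
  if (d <= N)%N then W%:R * e (b%:~R / d%:R * x%:~R) else 0 :> C.
Proof.
move=> cbd d0 dW NW.
have dn : d%:R != 0 :> R by rewrite pnatr_eq0 -lt0n.
have -> : \sum_(y < W) dirichlet N (x - y%:Z) * e (b%:~R / d%:R * y%:Z%:~R) =
    \sum_(s <- canonical_fractions N) e (s * x%:~R) *
      \sum_(y < W) e ((b%:~R / d%:R - s) * y%:Z%:~R) :> C.
  rewrite /dirichlet; under eq_bigr do rewrite mulr_suml.
  rewrite exchange_big/=; apply: eq_bigr => s _; rewrite mulr_sumr.
  by apply: eq_bigr => y _; rewrite -!eD intrB; congr e; ring.
have Z s : s \in canonical_fractions N -> ~ (exists k : int, b%:~R / d%:R - s = k%:~R :> R) ->
    \sum_(y < W) e ((b%:~R / d%:R - s) * y%:Z%:~R) = 0 :> C.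
  move=> /canonical_fractionsP[q [a [qN aq caq ->]]]; apply: sum_e_nint.
  have [k1 E1] := ratio_int b d0 dW.
  have q0 : (0 < q)%N by case/andP: qN.
  have [k2 E2] := ratio_int a%:Z q0 (NW q qN).
  by exists (k1 - k2); rewrite mulrBl E1 intrB -E2 -pmulrn.
case: ifPn => dN; last first.
  rewrite big_seq big1// => s sS; rewrite Z ?mulr0// => -[k E].
  have /canonical_fractionsP[q [a [/andP[q0 qN] aq caq sE]]] := sS.
  move: E; rewrite sE => /(canonical_fraction_eq cbd d0 caq q0) dq.
  by move: dN; rewrite dq qN.
pose a := `|(b %% d)%Z|%N.
have aE : a%:Z = (b %% d)%Z by rewrite /a gez0_abs// modz_ge0// eqz_nat -lt0n.
have ad : (a < d)%N by rewrite -ltz_nat aE ltz_pmod.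
have bE : b = (b %/ d)%Z * d%:Z + a%:Z by rewrite aE -divz_eq.
pose s0 : R := a%:R / d%:R.
have s0S : s0 \in canonical_fractions N.
  apply/canonical_fractionsP; exists d, a; split => //; first by rewrite d0.
  by move: cbd; rewrite {1}bE coprimez_sym /coprimez gcdzMDl -/(coprimez _ _) coprimez_sym coprimezE.
have bs0 : b%:~R / d%:R = s0 + (b %/ d)%Z%:~R.
  by rewrite [in LHS]bE intrD intrM -!pmulrn /s0; field.
rewrite (big_fsetD1 s0)//= big1_fset ?addr0; last first.
  move=> s; rewrite in_fsetD1 => /andP[ss0 sS] _; rewrite Z ?mulr0// => -[k E].
  have := canonical_fractions_itv sS; have := canonical_fractions_itv s0S.
  move=> /andP[u0 u1] /andP[v0 v1].
  have kE : (k - (b %/ d)%Z)%:~R = s0 - s by rewrite intrB -E bs0; ring.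
  have k1 : ((-1)%:~R : R) < (k - (b %/ d)%Z)%:~R by rewrite kE (_ : (-1)%:~R = -1)//; lra.
  have k2 : (k - (b %/ d)%Z)%:~R < (1%:~R : R) by rewrite kE (_ : 1%:~R = 1)//; lra.
  rewrite !ltr_int in k1 k2.
  have k0 : k - (b %/ d)%Z = 0 by lia.
  by move: kE; rewrite k0 => /esym/eqP; rewrite subr_eq0 eq_sym (negbTE ss0).
have -> : \sum_(y < W) e ((b%:~R / d%:R - s0) * y%:Z%:~R) = W%:R :> C.
  rewrite bs0 addrAC subrr add0r.
  under eq_bigr do rewrite -intrM e_int.
  by rewrite sumr_const card_ord.
rewrite mulrC; congr (_ * _); rewrite bs0 mulrDl.
by rewrite -intrM eDint.
Qed.

Definition cosine (q : nat) (x : int) : C := e (x%:~R / q%:R) + e (- (x%:~R / q%:R)).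

Lemma cosine_periodic q : (0 < q)%N -> zperiodic q (cosine q).
Proof.
move=> q0 x; have qn : q%:R != 0 :> R by rewrite pnatr_eq0 -lt0n.
rewrite /cosine intrD mulrDl -pmulrn divff// opprD.
by rewrite -[- 1]/((-1)%:~R) (eDint _ 1) eDint.
Qed.

(** Expanding the product gives frequencies that are sums of fractions 1/q_i and
    -1/q_i, and by coprimality no cancellation occurs in the denominator of
    such a sum. This is why the truncation by size of the denominator acts on a
    product of cosines as a whole. *)
Lemma prod_cosine_primitive (I : eqType) (r : seq I) (q : I -> nat) :
  uniq r -> (forall i, 0 < q i)%N -> pairwise_coprime q ->
  exists l : seq int, all (fun b => coprimez b (\prod_(i <- r) q i)%N) l /\
    forall x, \prod_(i <- r) cosine (q i) x =
      \sum_(b <- l) e (b%:~R / (\prod_(i <- r) q i)%:R * x%:~R).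
Proof.
move=> + q0 cq; elim: r => [_|i r IH /= /andP[ir ur]].
  exists [:: 0]; split; first by rewrite /= big_nil coprimezE coprimen1.
  by move=> x; rewrite !big_nil big_seq1 !mul0r e0.
have [l [lc lE]] := IH ur.
set d := \prod_(i <- r) q i in lc lE.
have cqd : coprime (q i) d by exact: coprime_prod_seq.
have d0 : (0 < d)%N by rewrite prodn_gt0.
have dn : d%:R != 0 :> R by rewrite pnatr_eq0 -lt0n.
have qn : (q i)%:R != 0 :> R by rewrite pnatr_eq0 -lt0n.
exists ([seq b * (q i)%:Z + d%:Z | b <- l] ++ [seq b * (q i)%:Z - d%:Z | b <- l]).
rewrite big_cons -/d; split.
  have cop (b : int) (s : int) : b \in l -> `|s|%N = 1%N ->
      coprimez (b * (q i)%:Z + s * d%:Z) (q i * d)%N.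
    move=> /(allP lc) cb s1; rewrite PoszM coprimezMr; apply/andP; split.
      by rewrite coprimez_sym /coprimez gcdzMDl -/(coprimez _ _) coprimezE abszM s1 mul1n.
    rewrite addrC coprimez_sym /coprimez gcdzMDl -/(coprimez _ _) coprimezMr.
    by rewrite coprimez_sym cb coprimez_sym coprimezE.
  rewrite all_cat !all_map; apply/andP; split; apply/allP => b bl /=.
    by have := cop b 1 bl erefl; rewrite mul1r.
  by have := cop b (-1) bl erefl; rewrite mulN1r.
move=> x; rewrite big_cons lE big_cat !big_map/= /cosine mulrDl !mulr_sumr.
congr (_ + _); apply: eq_bigr => b _; rewrite -eD; congr e;
  rewrite intrD ?intrN intrM -!pmulrn natrM; by field; rewrite dn qn.
Qed.

Lemma dirichlet_prod_cosine (I : eqType) (r : seq I) (q : I -> nat) (N W : nat) (x : int) :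
  uniq r -> (forall i, 0 < q i)%N -> pairwise_coprime q ->
  (\prod_(i <- r) q i %| W)%N -> (forall d, (0 < d <= N)%N -> (d %| W)%N) ->
  \sum_(y < W) dirichlet N (x - y%:Z) * \prod_(i <- r) cosine (q i) y%:Z =
  if (\prod_(i <- r) q i <= N)%N then W%:R * \prod_(i <- r) cosine (q i) x else 0.
Proof.
move=> ur q0 cq dW NW; have [l [lc lE]] := @prod_cosine_primitive I r q ur q0 cq.
have d0 : (0 < \prod_(i <- r) q i)%N by rewrite prodn_gt0.
under [LHS]eq_bigr => y _ do rewrite lE mulr_sumr.
rewrite exchange_big/= lE mulr_sumr.
transitivity (\sum_(b <- l) if (\prod_(i <- r) q i <= N)%N
    then W%:R * e (b%:~R / (\prod_(i <- r) q i)%:R * x%:~R) else 0 : C).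
  rewrite [LHS]big_seq [RHS]big_seq; apply: eq_bigr => b bl.
  exact: dirichlet_char x (allP lc b bl) d0 dW NW.
by case: ifP => _ //; rewrite big1.
Qed.

Lemma sum_e_ratio (j : int) (q : nat) : (0 < q)%N -> ~~ (q%:Z %| j)%Z ->
  \sum_(x < q) e (j%:~R / q%:R * x%:Z%:~R) = 0 :> C.
Proof.
move=> q0 nqj; have qn : q%:R != 0 :> R by rewrite pnatr_eq0 -lt0n.
apply: sum_e_nint; first exact: (ratio_int j q0 (dvdnn q)).
move=> [k /(congr1 (fun z => z * q%:R))]; rewrite divfK// => /eqP.
rewrite pmulrn -intrM eqr_int => /eqP E.
by move/negP: nqj; apply; rewrite E dvdz_mull.
Qed.

Lemma sum_cosine q : (2 < q)%N -> \sum_(x < q) cosine q x%:Z = 0.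
Proof.
move=> q2; have q0 : (0 < q)%N by lia.
have n1 : ~~ (q%:Z %| 1)%Z by rewrite dvdzE/= dvdn1; lia.
have n2 : ~~ (q%:Z %| (-1))%Z by rewrite dvdzE/= dvdn1; lia.
transitivity (\sum_(x < q) e (1%:~R / q%:R * x%:Z%:~R) +
  \sum_(x < q) e ((-1)%:~R / q%:R * x%:Z%:~R) : C).
  rewrite -big_split/=; apply: eq_bigr => x _; rewrite /cosine; congr (e _ + e _).
    by rewrite [RHS]mulrAC mul1r.
  by rewrite (_ : (-1)%:~R = -1)// [RHS]mulrAC mulN1r mulNr.
by rewrite !sum_e_ratio// addr0.
Qed.

Lemma sum_cosine_sqr q : (2 < q)%N -> \sum_(x < q) cosine q x%:Z ^+ 2 = (2 * q)%:R.
Proof.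
move=> q2; have q0 : (0 < q)%N by lia.
have qn : q%:R != 0 :> R by rewrite pnatr_eq0 -lt0n.
have n1 : ~~ (q%:Z %| 2)%Z by rewrite dvdzE/=; apply/negP => /dvdn_leq; lia.
have n2 : ~~ (q%:Z %| (-2))%Z by rewrite dvdzE/=; apply/negP => /dvdn_leq; lia.
transitivity (\sum_(x < q) e (2%:~R / q%:R * x%:Z%:~R) + (2 * q)%:R +
  \sum_(x < q) e ((-2)%:~R / q%:R * x%:Z%:~R) : C).
  have -> : (2 * q)%:R = \sum_(x < q) (2 : C) by rewrite sumr_const card_ord -mulrnA mulnC.
  rewrite -!big_split/=; apply: eq_bigr => x _.
  rewrite /cosine sqrrD -eD addrN e0 !expr2 -!eD; congr (_ + _ + _).
    by congr e; field.
  by congr e; rewrite (_ : (-2)%:~R = -2)//; field.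
by rewrite (sum_e_ratio q0 n1) (sum_e_ratio q0 n2) add0r addr0.
Qed.

Definition riesz (n : nat) (q : 'I_n -> nat) (c : C) (x : int) : C :=
  \prod_(i < n) (1 + c * cosine (q i) x).

Lemma riesz_periodic n (q : 'I_n -> nat) c : (forall i, 0 < q i)%N ->
  zperiodic (\prod_(i < n) q i) (riesz q c).
Proof.
move=> q0; apply: (@zperiodic_prod _ _ _ q (fun i x => 1 + c * cosine (q i) x)) => i x.
by rewrite cosine_periodic.
Qed.

(** Expand the first Riesz product over subsets S. The Dirichlet kernel keeps
    exactly the terms with product of moduli at most N, and by independence the
    mean of such a term against the second product is a product of the means
    of c' times a squared cosine, each equal to 2 c'. *)
Lemma pairing_riesz n (q : 'I_n -> nat) (c c' : C) (N W : nat) :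
  (forall i, 2 < q i)%N -> pairwise_coprime q ->
  (\prod_(i < n) q i %| W)%N -> (forall d, (0 < d <= N)%N -> (d %| W)%N) -> (0 < W)%N ->
  \sum_(i < W) \sum_(i' < W) dirichlet N (i%:Z - i'%:Z) * riesz q c i'%:Z * riesz q c' i%:Z
  = W%:R ^+ 2 * \sum_(S : {set 'I_n} | (\prod_(i in S) q i <= N)%N) (2 * c * c') ^+ #|S|.
Proof.
move=> q2 cq dW NW W0; have q0 i : (0 < q i)%N by have := q2 i; lia.
have FE x : riesz q c x = \sum_(S : {set 'I_n}) c ^+ #|S| * \prod_(i in S) cosine (q i) x.
  rewrite /riesz; under eq_bigr do rewrite addrC.
  rewrite bigA_distr; apply: eq_bigr => S _.
  by rewrite -big_mkcond/= big_split/= prodr_const.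
have HS (S : {set 'I_n}) : \sum_(i < W) riesz q c' i%:Z * \prod_(j in S) cosine (q j) i%:Z =
    W%:R * (2 * c') ^+ #|S|.
  pose f j x := (1 + c' * cosine (q j) x) * (if j \in S then cosine (q j) x else 1).
  have fq j : zperiodic (q j) (f j).
    by move=> x; rewrite /f cosine_periodic.
  have -> : \sum_(i < W) riesz q c' i%:Z * \prod_(j in S) cosine (q j) i%:Z =
      \sum_(i < W) \prod_(j < n) f j i%:Z.
    by apply: eq_bigr => i _; rewrite /f big_split/= -big_mkcond.
  have /dvdnP[k Wk] := dW.
  rewrite Wk (@sum_zperiodic _ (fun x => \prod_(j < n) f j x)); last exact: zperiodic_prod.
  rewrite (@sum_prod_coprime _ _ _ q f)//; last exact: index_enum_uniq.
  rewrite -[LHS]mulr_natl natrM -[RHS]mulrA; congr (_ * _).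
  have -> : (2 * c') ^+ #|S| = \prod_(j < n) (if j \in S then 2 * c' else 1).
    by rewrite -big_mkcond/= prodr_const.
  rewrite natr_prod -big_split/=; apply: eq_bigr => j _; rewrite /f.
  case: ifPn => _.
    under eq_bigr do rewrite mulrDl mul1r -mulrA -expr2.
    rewrite big_split/= -mulr_sumr sum_cosine// sum_cosine_sqr// natrM; ring.
  under eq_bigr do rewrite mulr1.
  by rewrite big_split/= -mulr_sumr sum_cosine// mulr0 addr0 sumr_const card_ord mulr1.
have -> : \sum_(i < W) \sum_(i' < W) dirichlet N (i%:Z - i'%:Z) * riesz q c i'%:Z * riesz q c' i%:Z =
    \sum_(i < W) \sum_(S : {set 'I_n}) c ^+ #|S| * (riesz q c' i%:Z *
     \sum_(i' < W) dirichlet N (i%:Z - i'%:Z) * \prod_(j in S) cosine (q j) i'%:Z).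
  apply: eq_bigr => i _.
  under eq_bigr do rewrite FE mulr_sumr mulr_suml.
  rewrite exchange_big/=; apply: eq_bigr => S _.
  by rewrite !mulr_sumr; apply: eq_bigr => i' _; ring.
rewrite exchange_big/= [in RHS]big_mkcond/= mulr_sumr; apply: eq_bigr => S _.
have KS (i : int) : \sum_(i' < W) dirichlet N (i - i'%:Z) * \prod_(j in S) cosine (q j) i'%:Z =
    if (\prod_(j in S) q j <= N)%N then W%:R * \prod_(j in S) cosine (q j) i else 0.
  have E (x : int) : \prod_(j in S) cosine (q j) x = \prod_(j <- enum S) cosine (q j) x.
    by rewrite big_enum.
  have -> : (\prod_(j in S) q j = \prod_(j <- enum S) q j)%N by rewrite big_enum.
  under [LHS]eq_bigr do rewrite E.
  rewrite E; apply: dirichlet_prod_cosine => //; first exact: enum_uniq.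
  apply: dvdn_trans dW.
  by rewrite big_enum/= [X in (_ %| X)%N](bigID (mem S))/= dvdn_mulr.
under eq_bigr do rewrite KS.
case: ifPn => _; last by rewrite big1 ?mulr0// => i _; rewrite !mulr0.
rewrite -mulr_sumr.
under eq_bigr do rewrite mulrCA.
by rewrite -mulr_sumr HS !exprMn expr2; ring.
Qed.

End Pairing.


(** * Norms of Riesz products *)

Section RieszNorms.
Context {R : realType}.
Local Notation C := R[i].

Lemma powR_prod (I : Type) (r : seq I) (f : I -> R) (a : R) : (forall i, 0 <= f i) ->
  (\prod_(i <- r) f i) `^ a = \prod_(i <- r) f i `^ a.
Proof.
move=> f0; elim: r => [|i r IH]; first by rewrite !big_nil powR1.
by rewrite !big_cons powRM ?IH// prodr_ge0.
Qed.

(** By the Chinese remainder theorem the factors of a Riesz product are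
    independent. *)
Lemma riesz_norm n (q : 'I_n -> nat) (c : C) (a A : R) (W : nat) :
  (forall i, 0 < q i)%N -> pairwise_coprime q -> (\prod_(i < n) q i %| W)%N -> 0 <= A ->
  (forall i, \sum_(x < q i) normc (1 + c * cosine (q i) x%:Z) `^ a <= (q i)%:R * A) ->
  \sum_(x < W) normc (riesz q c x%:Z) `^ a <= W%:R * A ^+ n.
Proof.
move=> q0 cq /dvdnP[k ->] A0 qA.
pose f i x := normc (1 + c * cosine (R := R) (q i) x) `^ a.
have fq i : zperiodic (q i) (f i) by move=> x; rewrite /f cosine_periodic.
have E x : normc (riesz q c x) `^ a = \prod_(i < n) f i x.
  by rewrite /riesz normc_prod powR_prod// => i; exact: normc_ge0.
under eq_bigr do rewrite E.
rewrite (@sum_zperiodic _ (fun x => \prod_(i < n) f i x)); last exact: zperiodic_prod.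
rewrite (@sum_prod_coprime _ _ _ q f)//; last exact: index_enum_uniq.
rewrite natrM -mulrA -[leLHS]mulr_natl ler_wpM2l//.
have -> : A ^+ n = \prod_(i < n) A by rewrite prodr_const card_ord.
rewrite natr_prod -big_split/=; apply: ler_prod => i _.
by rewrite qA andbT sumr_ge0// => x _; exact: powR_ge0.
Qed.

Definition rcosine (q : nat) (x : int) : R := 2 * cos (2 * pi * (x%:~R / q%:R)).

Lemma cosineE q x : cosine q x = (rcosine q x)%:C%C.
Proof.
by rewrite /cosine /e mulrN cosN sinN; apply: complexP; rewrite /= ?subrr// /rcosine; ring.
Qed.

Lemma sum_rcosine q : (2 < q)%N -> \sum_(x < q) rcosine q x%:Z = 0.
Proof.
move=> q2; apply: (@complexI R); rewrite rmorph_sum/=; apply: etrans (sum_cosine q2).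
by apply: eq_bigr => x _; rewrite cosineE.
Qed.

Lemma sum_rcosine_sqr q : (2 < q)%N -> \sum_(x < q) rcosine q x%:Z ^+ 2 = (2 * q)%:R.
Proof.
move=> q2; apply: (@complexI R); rewrite rmorph_sum rmorph_nat -(sum_cosine_sqr q2).
by apply: eq_bigr => x _; rewrite rmorphXn/= cosineE.
Qed.

Lemma rcosine_le2 q x : `|rcosine q x| <= 2.
Proof. by rewrite /rcosine normrM ger0_norm// -[leRHS]mulr1 ler_wpM2l// cos_max. Qed.

(** Young's inequality with second factor 1. *)
Lemma bernoulli_powR (y th : R) : -1 < y -> 0 < th < 1 -> (1 + y) `^ th <= 1 + th * y.
Proof.
move=> y1 /andP[t0 t1].
have q0 : 0 < (1 - th)^-1 by rewrite invr_gt0; lra.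
have p0 : 0 < th^-1 by rewrite invr_gt0.
have := @conjugate_powR R ((1 + y) `^ th) 1 th^-1 (1 - th)^-1 (powR_ge0 _ _) ler01 p0 q0.
rewrite !invrK mulr1 -powRrM mulfV ?gt_eqF// powRr1; last by lra.
by rewrite powR1 => H; apply: le_trans (H _) _; lra.
Qed.

(** For 1 < r < 2, writing (1 + y) ^ r = (1 + y) (1 + y) ^ (r - 1) and applying
    Bernoulli's inequality to the second factor yields a quadratic polynomial
    in y whose mean is computed exactly. After taking r-th roots the cost of a
    real perturbation is (r - 1) / r < 1/2 times its variance; an imaginary
    perturbation costs one half. *)
Lemma real_factor_norm (q : nat) (r s : R) : (2 < q)%N -> 1 < r < 2 -> 0 <= s -> 2 * s < 1 ->
  \sum_(x < q) normc (1 + s%:C%C * cosine q x%:Z) `^ r <= q%:R * (1 + 2 * (r - 1) * s ^+ 2).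
Proof.
move=> q2 /andP[r1 r2] s0 s1.
have sy x : `|s * rcosine q x| < 1.
  rewrite normrM (ger0_norm s0); apply: le_lt_trans s1.
  by rewrite mulrC ler_wpM2r// rcosine_le2.
apply: (@le_trans _ _ (\sum_(x < q) (1 + (r * s) * rcosine q x%:Z +
    ((r - 1) * s ^+ 2) * rcosine q x%:Z ^+ 2))).
  apply: ler_sum => x _; rewrite cosineE -rmorphM -(rmorph1 (real_complex R)) -rmorphD.
  rewrite normc_real; have := sy x%:Z; rewrite ltr_norml.
  set y := s * rcosine q x%:Z => /andP[y1 y2].
  rewrite ger0_norm; last by lra.
  have -> : r = 1 + (r - 1) by ring.
  rewrite powRD; last by apply/implyP => _; apply/eqP; lra.
  rewrite powRr1; last by lra.
  have -> : 1 + (1 + (r - 1)) * s * rcosine q x + (1 + (r - 1) - 1) * s ^+ 2 * rcosine q x ^+ 2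
    = (1 + y) * (1 + (r - 1) * y) by rewrite /y; ring.
  apply: ler_wpM2l; first by lra.
  by apply: bernoulli_powR => //; apply/andP; split; lra.
rewrite !big_split/= -[X in _ + X + _]mulr_sumr -[X in _ + X <= _]mulr_sumr sum_rcosine// sum_rcosine_sqr// sumr_const card_ord natrM.
by rewrite le_eqVlt; apply/orP; left; apply/eqP; ring.
Qed.

Lemma expR_le_quadratic (y : R) : 0 <= y <= 2^-1 -> expR y <= 1 + y + 2 * y ^+ 2.
Proof.
move=> /andP[y0 y1].
have : expR y * (1 - y) <= 1.
  rewrite -[leRHS](expRxMexpNx_1 y) ler_wpM2l ?expR_ge0//.
  exact: expR_ge1Dx.
have := expR_ge0 y; move: (expR y) => E E0 H.
have y2 : 0 <= y ^+ 2 by exact: sqr_ge0.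
have : (1 - y) * E <= (1 - y) * (1 + y + 2 * y ^+ 2).
  rewrite mulrC; apply: le_trans H _.
  have -> : (1 - y) * (1 + y + 2 * y ^+ 2) = 1 + y ^+ 2 * (1 - 2 * y) by ring.
  by rewrite lerDl mulr_ge0//; lra.
by rewrite ler_pM2l//; lra.
Qed.

(** The modulus of 1 + i y is the square root of 1 + y ^ 2, so for every
    exponent an imaginary perturbation of 1 costs half of its variance, up to a
    term of fourth order. *)
Lemma imaginary_factor_norm (q : nat) (a t : R) : (2 < q)%N -> 0 < a -> 0 <= t ->
  2 * a * t ^+ 2 <= 2^-1 ->
  \sum_(x < q) normc (1 + (0 +i* t)%C * cosine q x%:Z) `^ a <=
    q%:R * expR (a * t ^+ 2 + 4 * a ^+ 2 * t ^+ 4).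
Proof.
move=> q2 a0 t0 at1.
apply: (@le_trans _ _ (\sum_(x < q) (1 + (a * t ^+ 2 / 2 + 2 * a ^+ 2 * t ^+ 4) * rcosine q x%:Z ^+ 2))).
  apply: ler_sum => x _; rewrite cosineE.
  have := rcosine_le2 q x%:Z; set y := rcosine q x%:Z => y2.
  have yy : 0 <= y ^+ 2 <= 4.
    rewrite sqr_ge0/= -real_normK ?num_real// (_ : 4 = 2 ^+ 2); last by ring.
    by rewrite lerXn2r// nnegrE.
  have [yy0 yy4] := andP yy.
  have -> : normc (1 + (0 +i* t)%C * y%:C%C) = (1 + t ^+ 2 * y ^+ 2) `^ 2^-1.
    rewrite powR12_sqrt; last by rewrite addr_ge0// mulr_ge0// sqr_ge0.
    rewrite /normc/=; congr Num.sqrt; ring.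
  rewrite -powRrM.
  have tt : 0 <= t ^+ 2 by exact: sqr_ge0.
  apply: (@le_trans _ _ (expR (t ^+ 2 * y ^+ 2) `^ (2^-1 * a))).
    rewrite ge0_ler_powR ?nnegrE ?expR_ge0 ?expR_ge1Dx//; last first.
      by rewrite addr_ge0// mulr_ge0.
    by rewrite mulr_ge0 ?ltW.
  rewrite -expRM.
  have a2 : 0 <= 2^-1 * a by rewrite mulr_ge0// ltW.
  have u0 : 0 <= t ^+ 2 * y ^+ 2 * (2^-1 * a).
    by apply: mulr_ge0; [exact: mulr_ge0|exact: a2].
  have u1 : t ^+ 2 * y ^+ 2 * (2^-1 * a) <= 2^-1.
    apply: le_trans at1.
    have -> : 2 * a * t ^+ 2 = t ^+ 2 * 4 * (2^-1 * a) by field.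
    by rewrite ler_wpM2r ?ler_wpM2l.
  apply: le_trans (expR_le_quadratic _) _; first by rewrite u0.
  have -> : 1 + t ^+ 2 * y ^+ 2 * (2^-1 * a) + 2 * (t ^+ 2 * y ^+ 2 * (2^-1 * a)) ^+ 2 =
    1 + (a * t ^+ 2 / 2) * y ^+ 2 + (a ^+ 2 * t ^+ 4 / 2) * y ^+ 2 * y ^+ 2 by field.
  have -> : 1 + (a * t ^+ 2 / 2 + 2 * a ^+ 2 * t ^+ 4) * y ^+ 2 =
    1 + (a * t ^+ 2 / 2) * y ^+ 2 + (a ^+ 2 * t ^+ 4 / 2) * y ^+ 2 * 4 by field.
  rewrite lerD2l ler_wpM2l// mulr_ge0// divr_ge0// mulr_ge0//; first exact: sqr_ge0.
  by rewrite exprn_ge0.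
rewrite big_split/= -mulr_sumr sum_rcosine_sqr// sumr_const card_ord natrM.
apply: (@le_trans _ _ (q%:R * (1 + (a * t ^+ 2 + 4 * a ^+ 2 * t ^+ 4)))).
  by rewrite le_eqVlt; apply/orP; left; apply/eqP; field.
by rewrite ler_wpM2l// expR_ge1Dx.
Qed.

End RieszNorms.


(** * Truncations of the binomial expansion and the moduli *)

Section Combinatorics.
Context {R : realType}.
Local Notation C := R[i].

(** The sum of the terms of degree at most k in the expansion of (1 + z) ^ n,
    written over subsets because it arises in that form. *)
Definition truncated (n k : nat) (z : C) : C :=
  \sum_(S : {set 'I_n} | (#|S| <= k)%N) z ^+ #|S|.

Definition layer (n k : nat) : nat := #|[pred S : {set 'I_n} | #|S| == k]|.

Lemma sum_layer (K : pzSemiRingType) (n k : nat) (z : K) :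
  \sum_(S : {set 'I_n} | #|S| == k) z ^+ #|S| = z ^+ k *+ layer n k.
Proof.
rewrite (eq_bigr (fun=> z ^+ k)); last by move=> S /eqP ->.
by rewrite sumr_const.
Qed.

Lemma exp1D_layers (n : nat) (b : R) :
  (1 + b) ^+ n = \sum_(k < n.+1) b ^+ k *+ layer n k.
Proof.
transitivity (\sum_(S : {set 'I_n}) b ^+ #|S|).
  have -> : (1 + b) ^+ n = \prod_(i < n) (b + 1) by rewrite prodr_const card_ord addrC.
  rewrite bigA_distr; apply: eq_bigr => S _.
  by rewrite -big_mkcond/= prodr_const.
have cS (S : {set 'I_n}) : (#|S| < n.+1)%N by rewrite ltnS -[leqRHS]card_ord max_card.
rewrite (partition_big (fun S => Ordinal (cS S)) predT)//=.
apply: eq_bigr => k _; rewrite -sum_layer; apply: eq_bigl => S.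
by rewrite -val_eqE.
Qed.

Lemma large_layer (n : nat) (b : R) : 0 <= b ->
  exists2 k : nat, (k <= n)%N & (1 + b) ^+ n <= n.+1%:R * (b ^+ k *+ layer n k).
Proof.
move=> b0; apply: contrapT => H.
suff : (1 + b) ^+ n < (1 + b) ^+ n by rewrite ltxx.
rewrite {1}exp1D_layers.
have -> : (1 + b) ^+ n = \sum_(k < n.+1) (1 + b) ^+ n / n.+1%:R.
  by rewrite sumr_const card_ord -[RHS]mulr_natr divfK.
apply: ltr_sum => [|k _]; first by apply/hasP; exists ord0; rewrite ?mem_index_enum.
rewrite ltr_pdivlMr// mulrC ltNge; apply/negP => HH; apply: H; exists k => //.
by rewrite -ltnS.
Qed.

Lemma truncatedS n k z : truncated n k.+1 z = truncated n k z + z ^+ k.+1 *+ layer n k.+1.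
Proof.
rewrite /truncated -sum_layer (bigID (fun S : {set 'I_n} => (#|S| <= k)%N))/=.
congr (_ + _); apply: eq_bigl => S; lia.
Qed.

(** At z = i b the expansion oscillates, and complete it has modulus much
    smaller than (1 + b) ^ n. Yet some layer has modulus at least
    (1 + b) ^ n / (n + 1), and since a layer is a difference of consecutive
    truncations, one of these two is at least half as large. *)
Lemma large_truncation (n : nat) (b : R) : 0 <= b ->
  exists2 k : nat, (k <= n)%N &
    (1 + b) ^+ n <= 2 * n.+1%:R * normc (truncated n k (0 +i* b)%C).
Proof.
move=> b0; have [k kn Hk] := large_layer n b0.
set z := (0 +i* b)%C.
have nz : normc z = b by rewrite /= expr0n add0r sqrtr_sqr ger0_norm.
have nl j : normc (z ^+ j *+ layer n j) = b ^+ j *+ layer n j.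
  by rewrite -mulr_natr normcM normcX nz -(rmorph_nat (real_complex R)) normc_real ger0_norm// mulr_natr.
have n0 : 0 < n.+1%:R :> R by rewrite ltr0n.
case: k kn Hk => [|k] kn Hk.
  exists 0%N => //; apply: le_trans Hk _; rewrite -nl /truncated.
  rewrite -sum_layer (eq_bigl (fun S : {set 'I_n} => (#|S| <= 0)%N)); last first.
    by move=> S; rewrite leqn0.
  by rewrite -mulrA ler_peMl ?mulr_ge0 ?normc_ge0// ler1n.
have E : z ^+ k.+1 *+ layer n k.+1 = truncated n k.+1 z - truncated n k z.
  by rewrite truncatedS addrC addKr.
have tri : b ^+ k.+1 *+ layer n k.+1 <=
    normc (truncated n k.+1 z) + normc (truncated n k z).
  by rewrite -nl E; apply: le_trans (le_normcD _ _) _; rewrite normcN.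
have half (x y : R) : x <= 2 * y -> n.+1%:R * x <= 2 * n.+1%:R * y.
  by move=> xy; rewrite -mulrA mulrCA ler_wpM2l ?(ltW n0).
have [le|/ltW le] := leP (normc (truncated n k z)) (normc (truncated n k.+1 z)).
  by exists k.+1 => //; apply: le_trans Hk _; apply: half; lra.
exists k; first exact: ltnW.
by apply: le_trans Hk _; apply: half; lra.
Qed.

Definition scale (n : nat) : nat := ((n.+1 ^ n) * n`!)%N.

(** The moduli are congruent to 1 modulo a multiple of n!, as in Goedel's beta
    function, which makes them pairwise coprime. They all lie between scale n
    and (n + 1) scale n, and the factor (n + 1) ^ n in the scale makes any
    product of k + 1 of them larger than any product of k of them. *)
Definition modulus (n : nat) (i : 'I_n) : nat := (1 + i.+1 * scale n)%N.

Lemma scale_gt0 n : (0 < scale n)%N.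
Proof. by rewrite muln_gt0 expn_gt0 fact_gt0. Qed.

(** A common prime factor would divide the difference of two moduli, which is
    scale n times a number less than n; hence it would divide scale n, whereas
    the moduli are 1 modulo scale n. *)
Lemma modulus_coprime n : pairwise_coprime (@modulus n).
Proof.
move=> i j; wlog ij : i j / (i < j)%N.
  move=> H ij; have := ij; rewrite -val_eqE /= neq_ltn => /orP[/H|/H]; first exact.
  by rewrite coprime_sym; apply; rewrite eq_sym.
move=> _; apply/negPn/negP => cop.
have g1 : (1 < gcdn (modulus i) (modulus j))%N.
  rewrite ltn_neqAle eq_sym; apply/andP; split; first exact: cop.
  by rewrite gcdn_gt0.
have pp := pdiv_prime g1; set p := pdiv _ in pp.
have := pdiv_dvd (gcdn (modulus i) (modulus j)); rewrite -/p dvdn_gcd => /andP[pi pj].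
have ps : ~~ (p %| scale n)%N.
  apply/negP => ps; move: pi; rewrite /modulus (dvdn_addl _ (dvdn_mull i.+1 ps)) dvdn1 => /eqP p1.
  by move: pp; rewrite p1.
have := dvdn_sub pj pi; rewrite /modulus subnDl -mulnBl Euclid_dvdM// (negbTE ps) orbF.
rewrite subSS => pij; move/negP: ps; apply.
rewrite /scale; apply: dvdn_mull; apply: (dvdn_trans pij); apply: dvdn_fact.
rewrite subn_gt0 ij/=; have := ltn_ord j; lia.
Qed.

Lemma modulus_gt2 n (i : 'I_n) : (2 < modulus i)%N.
Proof.
rewrite /modulus /scale; case: n i => [[]//|n] i.
have f0 := fact_gt0 n.+1.
have e2 : (2 <= n.+2 ^ n.+1)%N by rewrite expnS -[leqLHS]muln1 leq_mul// expn_gt0.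
have : (2 <= n.+2 ^ n.+1 * n.+1`!)%N by rewrite -[leqLHS]muln1 leq_mul.
by move: (_ * _)%N => x x2; rewrite mulSn; lia.
Qed.

Definition level (n k : nat) : nat := (n.+1 * scale n) ^ k.

(** k moduli multiply to at most level n k, and k + 1 of them to more, because
    scale n is at least (n + 1) ^ k. Truncating by size of denominators thus
    amounts to truncating by degree. *)
Lemma modulus_level n k (S : {set 'I_n}) : (k <= n)%N ->
  (\prod_(i in S) modulus i <= level n k)%N = (#|S| <= k)%N.
Proof.
move=> kn; have s0 := scale_gt0 n.
have up (i : 'I_n) : (modulus i <= n.+1 * scale n)%N.
  by rewrite /modulus [leqRHS]mulSn; apply: leq_add => //; apply: leq_mul => //; exact: ltn_ord.
have lo (i : 'I_n) : (scale n < modulus i)%N by rewrite /modulus mulSn; lia.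
have b1 : (1 <= n.+1 * scale n)%N by rewrite muln_gt0.
case: (leqP #|S| k) => Sk.
  apply: (@leq_trans (\prod_(i in S) (n.+1 * scale n))%N).
    by apply: leq_prod => i _; exact: up.
  by rewrite prod_nat_const /level leq_pexp2l.
apply/negbTE; rewrite -ltnNge.
apply: (@leq_trans (\prod_(i in S) (scale n).+1)%N); last first.
  by apply: leq_prod => i _; exact: lo.
rewrite prod_nat_const /level.
apply: (@leq_trans ((scale n).+1 ^ k.+1)); last by rewrite leq_pexp2l.
rewrite expnMn expnS -[leqLHS]add1n.
have e1 : (n.+1 ^ k <= scale n)%N.
  rewrite /scale; apply: (@leq_trans (n.+1 ^ n)); first by rewrite leq_pexp2l.
  by rewrite leq_pmulr// fact_gt0.
have e2 : (scale n ^ k <= (scale n).+1 ^ k)%N.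
  by case: (k) => // k'; rewrite leq_exp2r.
have e3 : (0 < (scale n).+1 ^ k)%N by rewrite expn_gt0.
rewrite mulSn leq_add//; apply: leq_mul => //.
Qed.

(** The logarithm of the level is polynomial in n, which turns exponential
    growth in n into growth like the exponential of a power of ln N. *)
Lemma ln_level n k : (0 < n)%N -> (k <= n)%N -> ln (level n k)%:R <= 4 * n%:R ^+ 3 :> R.
Proof.
move=> n0 kn.
have fn : (n`! <= n.+1 ^ n)%N.
  elim: n {n0 k kn} => // n IH; rewrite factS expnS leq_mul//.
  apply: leq_trans IH _; case: n => // n; by rewrite leq_exp2r.
have lN : (level n k <= n.+1 ^ (n * (2 * n + 1)))%N.
  rewrite /level /scale; apply: (@leq_trans ((n.+1 ^ (2 * n + 1)) ^ n)); last first.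
    by rewrite -expnM mulnC.
  have e1 : (n.+1 * (n.+1 ^ n * n`!) <= n.+1 ^ (2 * n + 1))%N.
    by rewrite addn1 expnS mul2n -addnn expnD !leq_mul.
  apply: (@leq_trans ((n.+1 ^ (2 * n + 1)) ^ k)); first by case: (k) => // k'; rewrite leq_exp2r.
  by rewrite leq_pexp2l// expn_gt0.
have N0 : (0 < level n k)%N by rewrite expn_gt0 muln_gt0 scale_gt0.
apply: (@le_trans _ _ (ln (n.+1 ^ (n * (2 * n + 1)))%:R)).
  rewrite ler_ln ?posrE ?ltr0n//; first by rewrite ler_nat.
  by rewrite expn_gt0.
rewrite natrX lnXn ?ltr0n// -[leLHS]mulr_natl.
have l1 : ln n.+1%:R <= n%:R :> R.
  rewrite -[n.+1]add1n natrD; apply: le_ln1Dx; apply: lt_le_trans (ler0n _ n).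
  by rewrite ltrN10.
apply: (@le_trans _ _ ((n * (2 * n + 1))%:R * n%:R)); first by rewrite ler_wpM2l.
rewrite -natrX -!natrM ler_nat (expnSr n 2); nia.
Qed.

End Combinatorics.


(** * Exponential growth *)

Section Growth.
Context {R : realType}.
Local Notation C := R[i].

Lemma expR_sub_sqr (x : R) : 0 <= x -> expR (x - x ^+ 2) <= 1 + x.
Proof.
move=> x0; have x1 : 0 < 1 + x by lra.
apply: (@le_trans _ _ (expR (x / (1 + x)))).
  rewrite ler_expR ler_pdivlMr//.
  have -> : (x - x ^+ 2) * (1 + x) = x - x ^+ 3 by ring.
  by rewrite lerBlDr lerDl exprn_ge0.
have H : (1 + x)^-1 <= expR (- (x / (1 + x))).
  apply: le_trans (expR_ge1Dx _).
  by rewrite le_eqVlt; apply/orP; left; apply/eqP; field; rewrite gt_eqF.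
rewrite -[leRHS]invrK -[expR _]invrK -expRN lef_pV2 ?posrE ?invr_gt0 ?expR_gt0//.
Qed.

(** To leading order, with v = t ^ 2 and s = (a / 2) t, the right-hand side is
    the exponential of 2 t s = a v, while the two norms cost v and
    2 s ^ 2 / a = (a / 2) v. The balance (a / 2 - 1) v is positive because
    a > 2, and v is taken small enough to absorb the terms of order v ^ 2. *)
Lemma parameters (a : R) : 2 < a -> exists t s dl : R,
  [/\ 0 < t, 0 < s, 0 < dl & 2 * s < 1 /\ 2 * a * t ^+ 2 <= 2^-1] /\
     (expR dl * (expR (t ^+ 2 + 4 * a * t ^+ 4) * expR (2 * s ^+ 2 / a)) <= 1 + 2 * t * s).
Proof.
move=> a2; pose v := (a - 2) / (8 * a ^+ 2 * (a + 2)).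
have a0 : 0 < a by lra.
have ap2 : 0 < a + 2 by lra.
have am2 : 0 < a - 2 by lra.
have v0 : 0 < v by rewrite divr_gt0// !mulr_gt0// exprn_gt0.
have sv : Num.sqrt v ^+ 2 = v by rewrite sqr_sqrtr// ltW.
have vE : v * (8 * a ^+ 2 * (a + 2)) = a - 2.
  by rewrite /v divfK// !mulf_neq0 ?expf_neq0 ?gt_eqF.
have aa : 4 < a ^+ 2 by rewrite expr2; nra.
exists (Num.sqrt v), (a / 2 * Num.sqrt v), (v * (a / 2 - 1 - v * (a * (a + 4)))).
have t0 : 0 < Num.sqrt v by rewrite sqrtr_gt0.
have av : v * a ^+ 2 < 8^-1.
  have -> : v * a ^+ 2 = (a - 2) / (8 * (a + 2)).
    by rewrite /v; field; rewrite !gt_eqF.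
  by rewrite ltr_pdivrMr ?mulr_gt0//; lra.
split.
  split => //; first by rewrite mulr_gt0// divr_gt0.
    rewrite mulr_gt0// subr_gt0.
    have vv : v * (a * (a + 4)) < v * (8 * a ^+ 2 * (a + 2)) / 2.
      rewrite -mulrA ltr_pM2l//.
      have -> : 8 * a ^+ 2 * (a + 2) / 2 = a * (4 * a * (a + 2)) by field.
      by rewrite ltr_pM2l//; nra.
    by rewrite vE in vv; lra.
  split; last by rewrite sv; nra.
  have s2 : (2 * (a / 2 * Num.sqrt v)) ^+ 2 < 1.
    have -> : (2 * (a / 2 * Num.sqrt v)) ^+ 2 = a ^+ 2 * Num.sqrt v ^+ 2 by field.
    by rewrite sv mulrC; lra.
  rewrite ltNge; apply/negP => s1; move: s2; rewrite ltNge => /negP; apply.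
  by rewrite expr_ge1//; lra.
rewrite -!expRD.
have -> : 1 + 2 * Num.sqrt v * (a / 2 * Num.sqrt v) = 1 + a * Num.sqrt v ^+ 2 by field.
rewrite sv.
apply: le_trans (expR_sub_sqr _); last by rewrite mulr_ge0 ?ltW.
rewrite ler_expR le_eqVlt; apply/orP; left; apply/eqP.
have -> : Num.sqrt v ^+ 4 = (Num.sqrt v ^+ 2) ^+ 2 by ring.
have -> : 2 * (a / 2 * Num.sqrt v) ^+ 2 = a ^+ 2 / 2 * Num.sqrt v ^+ 2 by field.
by rewrite sv; field; rewrite gt_eqF.
Qed.

(** Data for one modulus: two perturbations c and c' of 1 for which 1 + b, where
    b is the modulus of the mean product of the perturbations, exceeds the
    product of the norms by the factor exp dl. Since that mean product is
    imaginary, 1 + b exceeds the mean of the product itself, and Hoelder's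
    inequality is not contradicted. *)
Definition gain (p q : R) (c c' : C) (Af Ag b dl : R) :=
  [/\ [/\ 0 < p, 0 < q & p^-1 + q^-1 = 1], [/\ 0 < Af, 0 < Ag, 0 < b & 0 < dl],
   2 * c * c' = (0 +i* b)%C,
   (forall k, (2 < k)%N -> \sum_(x < k) normc (1 + c * cosine k x%:Z) `^ p <= k%:R * Af) /\
   (forall k, (2 < k)%N -> \sum_(x < k) normc (1 + c' * cosine k x%:Z) `^ q <= k%:R * Ag) &
   expR dl * (Af `^ p^-1 * Ag `^ q^-1) <= 1 + b /\ expR dl <= 1 + b].

Lemma gain_sym p q c c' Af Ag b dl : gain p q c c' Af Ag b dl ->
  gain q p c' c Ag Af b dl.
Proof.
move=> [[p0 q0 pq] [A0 B0 b0 d0] cc [cA cB] [E1 E2]]; split => //.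
- by split => //; rewrite addrC.
- by rewrite -mulrA (mulrC c') mulrA.
- by split => //; rewrite (mulrC (Ag `^ _)).
Qed.

(** The real perturbation carries the exponent below 2 and the imaginary one the
    conjugate exponent above 2: each is cheapest there. *)
Lemma gain_exists_lt2 (r : R) : 1 < r -> r < 2 ->
  exists c c' Af Ag b dl, gain r (r / (r - 1)) c c' Af Ag b dl.
Proof.
move=> r1 r2; have r0 : 0 < r by lra.
have r10 : 0 < r - 1 by lra.
set a := r / (r - 1).
have a2 : 2 < a by rewrite /a ltr_pdivlMr//; lra.
have a0 : 0 < a by lra.
have [t [s [dl [[t0 s0 d0 [s1 at1]] E]]]] := parameters a2.
have s20 : 0 <= s ^+ 2 by exact: sqr_ge0.
have t20 : 0 <= t ^+ 2 by exact: sqr_ge0.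
have t40 : 0 <= t ^+ 4 by rewrite exprn_ge0// ltW.
exists s%:C%C, (0 +i* t)%C, (1 + 2 * (r - 1) * s ^+ 2),
  (expR (a * t ^+ 2 + 4 * a ^+ 2 * t ^+ 4)), (2 * t * s), dl.
have rs : 0 <= 2 * (r - 1) * s ^+ 2 by rewrite !mulr_ge0// ltW.
have ara : r^-1 + a^-1 = 1 by rewrite /a; field; rewrite !gt_eqF.
split.
- by split.
- by split => //; rewrite ?expR_gt0 ?mulr_gt0//; lra.
- rewrite -(rmorph_nat (real_complex R)) -rmorphM; apply: complexP => /=; ring.
- split=> k k2.
    apply: real_factor_norm => //; last exact: ltW.
    by rewrite r1.
  by apply: imaginary_factor_norm => //; exact: ltW.
have -> : expR (a * t ^+ 2 + 4 * a ^+ 2 * t ^+ 4) `^ a^-1 = expR (t ^+ 2 + 4 * a * t ^+ 4).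
  by rewrite -expRM; congr expR; field; rewrite gt_eqF.
split.
  apply: le_trans E; rewrite ler_wpM2l ?expR_ge0// mulrC ler_wpM2l ?expR_ge0//.
  apply: (@le_trans _ _ (expR (2 * (r - 1) * s ^+ 2) `^ r^-1)).
    rewrite ge0_ler_powR ?invr_ge0 ?nnegrE ?expR_ge0 ?expR_ge1Dx ?(ltW r0)//; lra.
  rewrite -expRM ler_expR le_eqVlt; apply/orP; left; apply/eqP.
  by rewrite /a; field; rewrite !gt_eqF.
apply: le_trans E; rewrite -[leLHS]mulr1 ler_wpM2l ?expR_ge0// -expRD.
apply: le_trans (expR_ge1Dx _); rewrite lerDl addr_ge0//.
  by apply: addr_ge0 => //; apply: mulr_ge0 => //; apply: mulr_ge0 => //; exact: ltW.
by apply: divr_ge0; [exact: mulr_ge0|exact: ltW].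
Qed.

Lemma gain_exists (p : R) : 1 < p -> p != 2 ->
  exists q c c' Af Ag b dl, gain p q c c' Af Ag b dl.
Proof.
move=> p1 p2; have p10 : 0 < p - 1 by lra.
have [plt|pge] := ltP p 2; first by exists (p / (p - 1)); exact: gain_exists_lt2.
have pgt : 2 < p by rewrite lt_neqAle eq_sym p2.
have r1 : 1 < p / (p - 1) by rewrite ltr_pdivlMr//; lra.
have r2 : p / (p - 1) < 2 by rewrite ltr_pdivrMr//; lra.
have [c [c' [Af [Ag [b [dl H]]]]]] := gain_exists_lt2 r1 r2.
have pE : p / (p - 1) / (p / (p - 1) - 1) = p.
  by field; rewrite ?gt_eqF//=; lra.
rewrite pE in H; exists (p / (p - 1)), c', c, Ag, Af, b, dl.
exact: gain_sym.
Qed.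

Lemma powR_exprn (A x : R) (n : nat) : 0 < A -> (A ^+ n) `^ x = (A `^ x) ^+ n.
Proof.
move=> A0; elim: n => [|n IH]; first by rewrite !expr0 powR1.
by rewrite !exprS powRM ?IH ?exprn_ge0 ?(ltW A0).
Qed.

(** Taking the product over n independent moduli raises the gain to the n-th
    power, at the price of the factor 2 (n + 1) lost when the truncation is
    chosen. The level is at least the largest admissible product of k moduli,
    and k > 0 because the truncation of degree 0 equals 1. *)
Lemma growth (p q : R) (c c' : C) (Af Ag b dl : R) (m : R -> C) :
  gain p q c c' Af Ag b dl ->
  schwartz m -> supported_on_Q m -> (exists x, m x != 0) ->
  exists2 kap : R, 0 < kap &
  forall (theta : nat -> R) (n : nat), (forall N, (0 < N)%N -> 0 < theta N) ->
  2 * n.+1%:R < expR dl ^+ n ->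
  exists N eps, [/\ (n < N)%N, ln (N%:R : R) <= 4 * n%:R ^+ 3, 0 < eps <= theta N &
    ((kap * (expR dl ^+ n / (2 * n.+1%:R)))%:E <=
      lp_opnorm p (TZ (bracket (canonical_fractions N) (dilate m eps))))%E].
Proof.
move=> [[p0 q0 pq] [A0 B0 b0 d0] cc [cA cB] [E1 E2]] sm mQ mn0.
have [kap k0 T] := transference sm mQ mn0; exists kap => // theta n th0 nlarge.
have nn0 : 0 < 2 * n.+1%:R :> R by rewrite mulr_gt0// ltr0n.
have npos : (0 < n)%N.
  by case: n nlarge {nn0} => //; rewrite expr0; lra.
have [k kn Hk] := large_truncation n (ltW b0).
have bn : expR dl ^+ n <= (1 + b) ^+ n.
  by rewrite lerXn2r ?nnegrE ?expR_ge0//; lra.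
(* otherwise the level would be 1 for every n *)
have kpos : (0 < k)%N.
  rewrite lt0n; apply/eqP => kz; move: Hk; rewrite kz.
  have -> : truncated n 0 (0 +i* b)%C = 1.
    rewrite /truncated (eq_bigl (pred1 (finset.set0 : {set 'I_n}))); last first.
      by move=> S; rewrite leqn0 cards_eq0.
    by rewrite big_pred1_eq cards0 expr0.
  by rewrite normc1 mulr1 leNgt => /negP; apply; exact: lt_le_trans bn.
pose N := level n k.
pose W := (N`! * \prod_(i < n) modulus i)%N.
have N0 : (0 < N)%N by rewrite expn_gt0 muln_gt0 scale_gt0.
have W0 : (0 < W)%N.
  by rewrite muln_gt0 fact_gt0 prodn_gt0// => i; exact: ltn_trans (modulus_gt2 i).
have m0 (i : 'I_n) : (0 < modulus i)%N := ltn_trans (isT : (0 < 2)%N) (modulus_gt2 i).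
have dW : (\prod_(i < n) modulus i %| W)%N by exact: dvdn_mull.
have NW d : (0 < d <= N)%N -> (d %| W)%N.
  by move=> dN; apply: dvdn_mulr; exact: dvdn_fact.
have PE := @pairing_riesz R n (@modulus n) c c' N W (@modulus_gt2 n) (@modulus_coprime n) dW NW W0.
rewrite cc in PE.
rewrite (eq_bigl (fun S : {set 'I_n} => (#|S| <= k)%N)) -/(truncated n k _) in PE; last first.
  by move=> S; exact: modulus_level.
have FA := @riesz_norm R n (@modulus n) c p Af W m0 (@modulus_coprime n) dW (ltW A0)
  (fun i => cA _ (modulus_gt2 i)).
have GB := @riesz_norm R n (@modulus n) c' q Ag W m0 (@modulus_coprime n) dW (ltW B0)
  (fun i => cB _ (modulus_gt2 i)).
have FW : zperiodic W (riesz (@modulus n) c).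
  by apply: (zperiodic_dvd dW); exact: riesz_periodic.
have GW : zperiodic W (riesz (@modulus n) c').
  by apply: (zperiodic_dvd dW); exact: riesz_periodic.
have W0' : 0 < W%:R :> R by rewrite ltr0n.
set P := truncated n k _ in Hk PE.
have P0 : 0 < normc P.
  rewrite -(pmulr_rgt0 _ nn0); apply: lt_le_trans Hk; rewrite exprn_gt0//; lra.
have Pn0 : W%:R ^+ 2 * P != 0 :> C.
  rewrite mulf_neq0 ?expf_neq0 ?pnatr_eq0 -?lt0n//.
  by apply/eqP => Pz; move: P0; rewrite Pz normc0 ltxx.
have := T p q (Af ^+ n) (Ag ^+ n) (theta N) N W _ _ p0 q0 pq (exprn_gt0 _ A0)
  (exprn_gt0 _ B0) (th0 N N0) W0 NW FW GW FA GB.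
rewrite /= PE => /(_ Pn0) [eps [epsN H]].
exists N, eps; split => //.
- rewrite /N /level -(prednK kpos) expnS.
  apply: (@leq_trans (n.+1 * scale n)); first by rewrite leq_pmulr// scale_gt0.
  by rewrite leq_pmulr// expn_gt0 muln_gt0 scale_gt0.
- exact: ln_level.
apply: le_trans H; rewrite lee_fin -[leRHS]mulrA ler_wpM2l ?(ltW k0)//.
have -> : normc (W%:R ^+ 2 * P) / W%:R ^+ 2 = normc P.
  rewrite normcM normcX -(rmorph_nat (real_complex R)) normc_real ger0_norm//.
  by rewrite mulrAC divff ?mul1r// expf_neq0// gt_eqF.
rewrite !powR_exprn// -exprMn.
have AB : 0 < Af `^ p^-1 * Ag `^ q^-1 by rewrite mulr_gt0// powR_gt0.
rewrite ler_pdivlMr ?exprn_gt0// mulrAC ler_pdivrMr// -exprMn [leRHS]mulrC.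
apply: le_trans Hk; rewrite lerXn2r ?nnegrE//; first by rewrite mulr_ge0 ?expR_ge0 ?(ltW AB).
by rewrite addr_ge0// ltW.
Qed.

(** Half of the exponential growth absorbs the factor 2 (n + 1) / kap; the other
    half dominates because (4 n ^ 3) ^ (1/4) = o(n). *)
Lemma exponential_wins (kap d : R) : 0 < kap -> 0 < d -> exists n0 : nat,
  forall n, (n0 <= n)%N -> 2 * n.+1%:R < expR d ^+ n /\
    forall x, 1 <= x <= 4 * n%:R ^+ 3 ->
      expR (x `^ (1 / 4)) <= kap * (expR d ^+ n / (2 * n.+1%:R)).
Proof.
move=> k0 d0.
have d20 : 0 < d ^+ 2 by rewrite exprn_gt0.
have d40 : 0 < d ^+ 4 by rewrite exprn_gt0.
pose X := 64 / d ^+ 4 + 32 / (kap * d ^+ 2) + 8 / d ^+ 2 + 1.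
have X1 : 0 < 64 / d ^+ 4 by rewrite divr_gt0.
have X2 : 0 < 32 / (kap * d ^+ 2) by rewrite divr_gt0// mulr_gt0.
have X3 : 0 < 8 / d ^+ 2 by rewrite divr_gt0.
exists (Num.truncn X).+1 => n nX.
have Xn : X < n%:R by apply: lt_le_trans (truncnS_gt X) _; rewrite ler_nat.
have n1 : 1 <= n%:R :> R by rewrite /X in Xn; lra.
have n0 : 0 < n%:R :> R by lra.
have nS : n.+1%:R = n%:R + 1 :> R by rewrite -addn1 natrD.
have nS2 : n.+1%:R <= 2 * n%:R :> R by rewrite nS; lra.
have e2 (y : R) : 0 <= y -> y ^+ 2 / 2 < expR y.
  by move=> y0; have := expR_ge1Dxn 1 y0; rewrite (_ : 2`!%:R = 2)//; lra.
rewrite -expRM_natl (mulrC n%:R d).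
split.
  apply: le_lt_trans (e2 _ _); last by rewrite mulr_ge0 ?(ltW d0).
  have h : 8 < n%:R * d ^+ 2 by rewrite -ltr_pdivrMr//; rewrite /X in Xn; lra.
  have -> : (d * n%:R) ^+ 2 / 2 = n%:R * d ^+ 2 * n%:R / 2 by ring.
  have := ltr_pM2r n0 8 (n%:R * d ^+ 2); rewrite h; lra.
move=> x /andP[x1 x2].
have hh : x `^ (1 / 4) <= d / 2 * n%:R.
  have y0 : 0 <= d / 2 * n%:R by rewrite mulr_ge0 ?divr_ge0 ?(ltW d0).
  have -> : d / 2 * n%:R = ((d / 2 * n%:R) ^+ 4) `^ (1 / 4).
    by rewrite -powR_mulrn// -powRrM mul1r divff// powRr1.
  have q4 : 0 <= 1 / 4 :> R by lra.
  have x0 : 0 <= x by lra.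
  rewrite ge0_ler_powR ?nnegrE ?exprn_ge0//.
  apply: le_trans x2 _.
  have -> : (d / 2 * n%:R) ^+ 4 = (n%:R * d ^+ 4 / 16) * n%:R ^+ 3 by field.
  rewrite ler_wpM2r ?exprn_ge0//.
  have : 64 < n%:R * d ^+ 4 by rewrite -ltr_pdivrMr//; rewrite /X in Xn; lra.
  lra.
have -> : d * n%:R = d / 2 * n%:R + d / 2 * n%:R by field.
rewrite expRD.
apply: (@le_trans _ _ (expR (d / 2 * n%:R))); first by rewrite ler_expR.
set E := expR _.
have E0 : 0 < E by exact: expR_gt0.
have : 2 * n.+1%:R <= kap * E.
  apply: (@le_trans _ _ (kap * ((d / 2 * n%:R) ^+ 2 / 2))); last first.
    by rewrite ler_pM2l// ltW// e2// mulr_ge0 ?divr_ge0 ?(ltW d0).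
  have h : 32 < n%:R * (kap * d ^+ 2) by rewrite -ltr_pdivrMr ?mulr_gt0//; rewrite /X in Xn; lra.
  have -> : kap * ((d / 2 * n%:R) ^+ 2 / 2) = n%:R * (kap * d ^+ 2) * n%:R / 8 by field.
  have := ltr_pM2r n0 32 (n%:R * (kap * d ^+ 2)); rewrite h; lra.
move=> H; rewrite mulrA ler_pdivlMr ?mulr_gt0 ?ltr0n//.
by rewrite (_ : kap * (E * E) = E * (kap * E)) ?ler_pM2l//; ring.
Qed.

Lemma infinite_nat_set (A : set nat) : (forall B, exists2 n, A n & (B <= n)%N) -> infinite_set A.
Proof.
move=> H /finite_seqP[s As]; have [n An nB] := H (\max_(i <- s) i).+1.
by move: An; rewrite As /= => ns; have := @leq_bigmax_seq _ s xpredT id n ns erefl; rewrite leqNgt nB.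
Qed.

End Growth.

Unset Implicit Arguments.

Theorem theorem1p15 (R : realType) (p : R) (p_gt1 : 1 < p) (p_neq2 : p != 2) :
  exists c : R, 0 < c < 1 /\
  exists C : R, 0 < C /\
  forall m : R -> R[i]%C,
    schwartz m -> supported_on_Q m -> (exists x, m x != 0) ->
  forall theta : nat -> R,
    (forall N, (0 < N)%N -> 0 < theta N < 1) ->
  infinite_set [set N : nat | (0 < N)%N /\
    expR (ln N%:R `^ c) = N%:R `^ (1 / ln N%:R `^ (1 - c)) /\
    exists eps : R, 0 < eps <= theta N /\
      ((C * expR (ln N%:R `^ c))%:E <=
        lp_opnorm p (TZ (bracket (canonical_fractions N) (dilate m eps))))%E].
Proof.
exists (1 / 4); split; first by apply/andP; split; lra.
exists 1; split => // m sm mQ mn0 theta th.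
have [q [c [c' [Af [Ag [b [dl G]]]]]]] := gain_exists p_gt1 p_neq2.
have d0 : 0 < dl by case: G => [_ []].
have [kap k0 growthN] := growth G sm mQ mn0.
have [n0 n0P] := exponential_wins k0 d0.
have th0 N : (0 < N)%N -> 0 < theta N by move=> /th/andP[].
apply: infinite_nat_set => B.
pose n := maxn (maxn n0 B) 3.
have [nlarge nwin] := n0P n (leq_trans (leq_maxl _ _) (leq_maxl _ _)).
have [N [eps [nN lnN epsN H]]] := growthN theta n th0 nlarge.
exists N; last by apply: leq_trans (ltnW nN); rewrite !leq_max leqnn orbT.
have N3 : (3 < N)%N by apply: leq_trans nN; rewrite ltnS leq_max leqnn orbT.
have lnN1 : 1 <= ln (N%:R : R).
  rewrite -[leLHS](expRK 1) ler_ln ?posrE ?expR_gt0 ?ltr0n ?(leq_trans _ N3)//.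
  apply: (@le_trans _ _ 4%:R); last by rewrite ler_nat.
  have h2 : expR (2^-1 : R) <= 2.
    apply: le_trans (expR_le_quadratic _) _; first by apply/andP; split; lra.
    by rewrite expr2; lra.
  have -> : expR (1 : R) = expR 2^-1 * expR 2^-1 by rewrite -expRD; congr expR; field.
  have -> : 4%:R = 2 * 2 :> R by ring.
  by apply: ler_pM; rewrite ?expR_ge0.
have lnN0 : 0 < ln (N%:R : R) by apply: lt_le_trans lnN1.
split; first exact: leq_trans N3.
split.
  rewrite [RHS]/powR pnatr_eq0 gtn_eqF ?(leq_trans _ N3)//; congr expR.
  have lp : 0 < ln (N%:R : R) `^ (1 - 1 / 4) by exact: powR_gt0.
  rewrite (mul1r (_ `^ _)^-1); apply: (mulfI (lt0r_neq0 lp)); rewrite [RHS]mulrA mulfV ?lt0r_neq0// [RHS]mul1r.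
  by rewrite -powRD ?(gt_eqF lnN0) ?implybT// subrK powRr1// (ltW lnN0).
exists eps; split => //; rewrite mul1r; apply: le_trans H; rewrite lee_fin.
by apply: nwin; rewrite lnN1.
Qed.
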